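(* Let $\theta\in\Omega^2(\mathbb{S}^6)$ be a $G_2$-invariant potential of $\omega$ (i.e. $d\theta=\omega$). Let $\xi,\eta\in\mathfrak{g}_2$ with $[\xi,\eta]=0$ and put $H_{(\xi,\eta)}:=-\iota_{X_\xi\wedge X_\eta}\theta\in C^\infty(\mathbb{S}^6)$. Then $(H_{(\xi,\eta)},X_\xi\wedge X_\eta)$ is a solution of the Hamilton-de Donder-Weyl equation, i.e. $\iota_{X_\xi\wedge X_\eta}\omega=-dH_{(\xi,\eta)}$. Furthermore, for every $p\in\mathbb{S}^6$ the map $$\psi_p^{\xi,\eta}:\mathbb{R}^2\to\mathbb{S}^6,\quad \psi_p^{\xi,\eta}(t^1,t^2)=\varphi^{X_\eta}_{t^2}\circ\varphi^{X_\xi}_{t^1}(p)$$ is a solution of the dynamical Hamilton-de Donder-Weyl equation with respect to $H_{(\xi,\eta)}$ and the co-volume $\frac{\partial}{\partial t^1}\wedge\frac{\partial}{\partial t^2}$, where $\varphi^Z_t$ denotes the flow of a vector field $Z$ at time $t$. In this case, the image of $\psi_p^{\xi,\eta}$ is either an immersed submanifold of $\mathbb{S}^6$ diffeomorphic to a torus of dimension $0$, $1$ or $2$, or an injectively immersed $\mathbb{R}$ whose closure is a $2$-dimensional torus.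
   Context: The octonions $\mathbb{O}$ are the real algebra with vector space basis $e_0,e_1,\dots,e_7$, unit $e_0=1$, and products $e_ie_j=-\delta_{ij}+\sum_{k=1}^7\epsilon_{ijk}e_k$ for $i,j\in\{1,\dots,7\}$, where $\epsilon_{ijk}$ is completely antisymmetric, equal to $1$ for $ijk=123,145,167,246,275,374,365$, and $0$ whenever $(i,j,k)$ is not a permutation of one of these triples. The imaginary octonions (span of $e_1,\dots,e_7$) are identified with $\mathbb{R}^7$ with its standard scalar product $\langle\cdot,\cdot\rangle$. The cross product on $\mathbb{R}^7$ is $u\times v:=\frac12(u\cdot v-v\cdot u)$. The constant-coefficient $3$-form $\widetilde\omega$ on $\mathbb{R}^7$ is $\widetilde\omega(u,v,w)=\langle u\times v,w\rangle$. Let $j:\mathbb{S}^6\hookrightarrow\mathbb{R}^7$ be the inclusion of the unit sphere and $\omega:=j^*\widetilde\omega\in\Omega^3(\mathbb{S}^6)$. $G_2\subset GL(7,\mathbb{R})$ is the image of the group of $\mathbb{R}$-algebra automorphisms of $\mathbb{O}$ under restriction to the imaginary octonions $\mathbb{R}^7$; it is a closed subgroup of $SO(7,\mathbb{R})$ and acts on $\mathbb{S}^6$ preserving $\omega$. Its Lie algebra is $\mathfrak{g}_2$, and $X_\xi$ denotes the fundamental vector field on $\mathbb{S}^6$ of $\xi\in\mathfrak{g}_2$, $X_\xi(p)=\frac{d}{dt}\big|_{t=0}e^{t\xi}\cdot p$. A $G_2$-invariant potential of $\omega$ exists, e.g. $j^*(\frac13\iota_E\widetilde\omega)$ with $E$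 the Euler vector field on $\mathbb{R}^7$. Contraction with a decomposable bivector field is $\iota_{X\wedge Y}=\iota_Y\iota_X$. On a $2$-plectic manifold $(M,\omega)$, a couple $(H,Z)$ of a function $H$ and a bivector field $Z$ solves the Hamilton-de Donder-Weyl (HDW) equation in dimension two if $\iota_Z\omega=-dH$. A smooth map $\psi:\Sigma\to M$ from a $2$-dimensional manifold with co-volume $\gamma$ (a nowhere vanishing bivector field on $\Sigma$) solves the dynamical HDW equation with respect to $H$ if $\iota_{(\psi_* )_x(\gamma_x)}\omega_{\psi(x)}=-(dH)_{\psi(x)}$ for all $x\in\Sigma$. *)

(* Defs.v *)
From HB Require Import structures.
From mathcomp Require Import all_boot all_order all_algebra.
From mathcomp Require Import all_classical all_reals all_analysis.

Set Implicit Arguments.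
Unset Strict Implicit.
Unset Printing Implicit Defensive.

Import Order.TTheory GRing.Theory Num.Theory.
Import numFieldNormedType.Exports.

Local Open Scope classical_set_scope.
Local Open Scope ring_scope.

(* Vectors are row vectors; a square matrix g acts on the left on a vector p by
   p *m g^T. A k-tuple of vectors in R^n is the k x n matrix of its rows. *)

Section Smooth.
Context {R : realType}.

(* For finite-dimensional V, f is C^k iff it is continuous and, when k > 0, its
   directional derivatives exist everywhere and are C^(k-1). *)
Fixpoint Ck (k : nat) {V W : normedModType R} (f : V -> W) : Prop :=
  continuous f /\
  (if k is k'.+1 then
     forall v : V, (forall x, derivable f x v) /\ Ck k' (fun x => 'D_v f x)
   else True).

Definition smooth {V W : normedModType R} (f : V -> W) : Prop :=
  forall k, Ck k f.

Definition immersion {V W : normedModType R} (f : V -> W) : Prop :=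
  smooth f /\ forall x : V, injective ('d f x : V -> W).

End Smooth.

Section Octonions.
Context {R : realType}.

Definition octonion := 'rV[R]_(1 + 7).

Definition octonion_triples : seq (nat * nat * nat) :=
  [:: (1, 2, 3); (1, 4, 5); (1, 6, 7); (2, 4, 6);
      (2, 7, 5); (3, 7, 4); (3, 6, 5)]%N.

Definition octonion_eps (i j k : nat) : R :=
  let T := octonion_triples in
  [|| (i, j, k) \in T, (j, k, i) \in T | (k, i, j) \in T]%:R
  - [|| (j, i, k) \in T, (i, k, j) \in T | (k, j, i) \in T]%:R.

Definition octonion_e (i : 'I_(1 + 7)) : octonion := delta_mx 0 i.

Definition octonion_ee (i j : 'I_(1 + 7)) : octonion :=
  if i == 0 then octonion_e j
  else if j == 0 then octonion_e i
  else - ((i == j)%:R *: octonion_e 0)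
       + \sum_(k : 'I_(1 + 7) | k != 0) octonion_eps i j k *: octonion_e k.

Definition octonion_mul (x y : octonion) : octonion :=
  \sum_i \sum_j (x 0 i * y 0 j) *: octonion_ee i j.

Definition octonion_im (v : 'rV[R]_7) : octonion := row_mx 0 v.

(* The combination of products is purely imaginary, so nothing is lost by
   dropping its e_0 coordinate. *)
Definition cross (u v : 'rV[R]_7) : 'rV[R]_7 :=
  rsubmx (2^-1 *: (octonion_mul (octonion_im u) (octonion_im v)
                   - octonion_mul (octonion_im v) (octonion_im u))).

(* Bijectivity and multiplicativity force f 1 = 1. *)
Definition octonion_aut (f : octonion -> octonion) : Prop :=
  [/\ linear f, bijective f
    & forall x y, f (octonion_mul x y) = octonion_mul (f x) (f y)].

Definition G2 : set 'M[R]_7 :=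
  [set g | exists f, octonion_aut f /\
     forall v : 'rV[R]_7, f (octonion_im v) = octonion_im (v *m g^T)].

Definition expmx (A : 'M[R]_7) : 'M[R]_7 :=
  limn (series (fun n => (n`!%:R)^-1 *: A ^+ n)).

(* The Lie algebra of the closed subgroup G2 of GL(7, R). *)
Definition g2 : set 'M[R]_7 :=
  [set xi | forall t : R, G2 (expmx (t *: xi))].

Definition lie_bracket (xi eta : 'M[R]_7) : 'M[R]_7 := xi * eta - eta * xi.

Definition fundamental (xi : 'M[R]_7) (p : 'rV[R]_7) : 'rV[R]_7 :=
  derive1 (fun t : R => p *m (expmx (t *: xi))^T) 0.

End Octonions.

Arguments octonion R : clear implicits.
Arguments G2 R : clear implicits.
Arguments g2 R : clear implicits.

Section Forms.
Context {R : realType}.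

Definition dform (k n : nat) := 'rV[R]_n -> 'M[R]_(k, n) -> R.

Definition pullback k m n (f : 'rV[R]_m -> 'rV[R]_n) (a : dform k n) :
    dform k m :=
  fun x v => a (f x) (v *m 'J f x).

(* Exterior derivative on R^n:
   (da)_x(v_0,..,v_k) =
     sum_i (-1)^i D_(v_i) [a(v_0,..,v_(i-1),v_(i+1),..,v_k)](x). *)
Definition ext_d k n (a : dform k n) : dform k.+1 n :=
  fun x v => \sum_(i < k.+1)
    (-1) ^+ i * 'D_(row i v) (fun y => a y (row' i v)) x.

(* A bivector at a point is encoded as a linear functional on the alternating
   bilinear forms there, via Lambda^2 V = (Lambda^2 V^* )^*. *)
Definition bivector (n : nat) := ('M[R]_(2, n) -> R) -> R.

Definition wedge_vectors n (X Y : 'rV[R]_n) : bivector n := fun b => b (col_mx X Y).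

Definition push_bivector m n (J : 'M[R]_(m, n)) (Z : bivector m) : bivector n :=
  fun b => Z (fun u => b (u *m J)).

(* In particular iota_bivector (wedge_vectors X Y) a v = a (X, Y, v), that is,
   contraction with X /\ Y is iota_Y iota_X. *)
Definition iota_bivector k n (Z : bivector n) (a : 'M[R]_(2 + k, n) -> R) :
    'M[R]_(k, n) -> R :=
  fun v => Z (fun u => a (col_mx u v)).

End Forms.

Arguments dform R k n : clear implicits.
Arguments bivector R n : clear implicits.

Section Sphere.
Context {R : realType}.

Definition scalar_prod n (u v : 'rV[R]_n) : R := \sum_i u 0 i * v 0 i.

Definition sphere : set 'rV[R]_7 := [set p | scalar_prod p p = 1].

Definition tangent k (p : 'rV[R]_7) (v : 'M[R]_(k, 7)) : Prop :=
  forall i, scalar_prod (row i v) p = 0.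

(* The stereographic atlas of the sphere: b = false projects from the north pole
   (0,..,0,1) and b = true from the south pole. *)
Definition stereo (b : bool) (p : 'rV[R]_7) : 'rV[R]_6 :=
  let p' : 'rV[R]_(6 + 1) := p in
  (1 - (-1) ^+ b * p 0 ord_max)^-1 *: lsubmx p'.

Definition stereo_inv (b : bool) (x : 'rV[R]_6) : 'rV[R]_7 :=
  let q := scalar_prod x x in
  (row_mx ((2 / (q + 1)) *: x) (const_mx ((-1) ^+ b * ((q - 1) / (q + 1))))
   : 'rV[R]_(6 + 1)).

Definition alternating_at k (p : 'rV[R]_7) (a : 'M[R]_(k, 7) -> R) : Prop :=
  (forall (i : 'I_k) (A B C : 'M[R]_(k, 7)) (b c : R),
      tangent p A -> tangent p B -> tangent p C ->
      row i A = b *: row i B + c *: row i C ->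
      row' i B = row' i A -> row' i C = row' i A ->
      a A = b * a B + c * a C) /\
  (forall (i j : 'I_k) (A : 'M[R]_(k, 7)),
      tangent p A -> i != j -> row i A = row j A -> a A = 0).

(* Differential k-forms on the sphere. Only the values of a at points of the
   sphere and on tangent vectors are meaningful. *)
Definition sphere_form k (a : dform R k 7) : Prop :=
  (forall p, sphere p -> alternating_at p (a p)) /\
  (forall (b : bool) (v : 'M[R]_(k, 6)),
      smooth (fun x => pullback (stereo_inv b) a x v)).

Definition sphere_form_eq k (a a' : dform R k 7) : Prop :=
  forall p, sphere p -> forall v, tangent p v -> a p v = a' p v.

(* Exterior derivative on the sphere: at p, the derivative of the expression of a
   in one of the two stereographic charts around p (the one projecting from the
   pole opposite to p's hemisphere), carried back to the sphere. *)
Definition sphere_d k (a : dform R k 7) : dform R k.+1 7 :=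
  fun p => let b := 0 < p 0 ord_max in
    pullback (stereo b) (ext_d (pullback (stereo_inv b) a)) p.

Definition form_of_fun (H : 'rV[R]_7 -> R) : dform R 0 7 := fun p _ => H p.

Definition octonion_form : dform R 3 7 :=
  fun _ v => scalar_prod (cross (row 0 v) (row 1 v)) (row ord_max v).

Definition G2_invariant k (a : dform R k 7) : Prop :=
  forall g, G2 R g -> sphere_form_eq (fun p v => a (p *m g^T) (v *m g^T)) a.

Definition sphere_bivector_field (Z : 'rV[R]_7 -> bivector R 7) : Prop :=
  (forall p, sphere p -> exists s : seq ('rV[R]_7 * 'rV[R]_7),
      (forall XY, XY \in s -> tangent p XY.1 /\ tangent p XY.2) /\
      Z p = fun b => \sum_(XY <- s) wedge_vectors XY.1 XY.2 b) /\
  (forall a : dform R 2 7, sphere_form a ->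
      sphere_form (form_of_fun (fun p => Z p (a p)))).

Definition hdw_solution (w : dform R 3 7)
    (H : 'rV[R]_7 -> R) (Z : 'rV[R]_7 -> bivector R 7) : Prop :=
  [/\ sphere_form (form_of_fun H), sphere_bivector_field Z &
      sphere_form_eq (fun p => iota_bivector (k := 1) (Z p) (w p))
                     (fun p v => - sphere_d (form_of_fun H) p v)].

Definition dynamical_hdw_solution (w : dform R 3 7) (H : 'rV[R]_7 -> R)
    (gamma : 'rV[R]_2 -> bivector R 2) (psi : 'rV[R]_2 -> 'rV[R]_7) : Prop :=
  [/\ smooth psi, forall x, sphere (psi x) &
      forall x v, tangent (psi x) v ->
        iota_bivector (k := 1) (push_bivector ('J psi x) (gamma x)) (w (psi x)) v
        = - sphere_d (form_of_fun H) (psi x) v].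

Definition coordinate_covolume (x : 'rV[R]_2) : bivector R 2 :=
  wedge_vectors (delta_mx 0 0) (delta_mx 0 1).

Definition integral_curve (X : 'rV[R]_7 -> 'rV[R]_7) (p : 'rV[R]_7)
    (c : R -> 'rV[R]_7) : Prop :=
  c 0 = p /\ forall t : R, sphere (c t) /\ is_derive t 1 c (X (c t)).

(* The constant curve is a dummy value; on the compact sphere smooth vector
   fields are complete and integral curves are unique. *)
Definition flow (X : 'rV[R]_7 -> 'rV[R]_7) (t : R) (p : 'rV[R]_7) : 'rV[R]_7 :=
  xget (fun _ : R => p) [set c | integral_curve X p c] t.

(* A is the image of an injective immersion of R^k / Z^k, whose smooth maps are
   the Z^k-periodic smooth maps of R^k; for k = 0 it is a point. *)
Definition immersed_torus (k : nat) (A : set 'rV[R]_7) : Prop :=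
  exists F : 'rV[R]_k -> 'rV[R]_7,
    [/\ immersion F, range F = A &
        forall x y, F x = F y <->
          exists z : 'rV[int]_k, y = x + map_mx intr z].

Definition injectively_immersed_line (A : set 'rV[R]_7) : Prop :=
  exists F : R^o -> 'rV[R]_7, [/\ immersion F, injective F & range F = A].

End Sphere.

Arguments sphere R : clear implicits.

(* Main.v *)
Require Import Defs.
From HB Require Import structures.
From mathcomp Require Import all_boot all_order all_algebra.
From mathcomp Require Import all_classical all_reals all_analysis.
From mathcomp Require Import complex ring lra.

Set Implicit Arguments.
Unset Strict Implicit.
Unset Printing Implicit Defensive.

Import Order.TTheory GRing.Theory Num.Theory.
Import numFieldNormedType.Exports.
Local Open Scope classical_set_scope.
Local Open Scope ring_scope.

(** Why the statement holds.

    Elements of the Lie algebra of [G2] act on imaginary octonions as derivations: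
    they are skew for the scalar product and satisfy the Leibniz rule for the cross
    product ([g2_derivation]). The fundamental fields are therefore the linear fields
    [p |-> D1 p] and [p |-> D2 p] of two commuting derivations.

    The Hamilton-de Donder-Weyl equation. [G2] acts transitively on basic triples,
    i.e. orthonormal [a, b, c] with [c] orthogonal to [a x b] ([frame_G2]). This
    leaves only the multiples of [<p x u, v>] as invariant two-forms on the sphere
    ([invariant_two_form]), and the equation [d theta = omega], tested at one point,
    fixes the factor [1 / 3] ([potential_explicit]). The Hamiltonian is thus
    [- 1 / 3 <p x D1 p, D2 p>]; because [D1] and [D2] are commuting derivations, the
    three terms of the differential of [<p x D1 p, D2 p>] in the direction [v] add up
    to [3 <D1 p x D2 p, v>], which is three times the contraction of [omega]
    ([derive_hamiltonian], [hamiltonian_d]). The dynamical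
    equation follows, as the partial derivatives of [psi] are the two fields.

    The shape of the orbits. Two commuting skew matrices of odd size have a common
    kernel vector [a] ([common_kernel]). The operators [u |-> a x (D u)] are then
    symmetric and commute, so they have common eigenvectors; these supply a basic
    triple [a, b, c] in which both derivations are infinitesimal rotations of the
    planes of [b], [c] and [b x c] ([adapted_triple]), with angular velocities of sum
    zero. Hence the flows are explicit rotations ([flow_rotate]), and [psi] is the
    image of a linear map from the plane of times to the plane of triples of angles
    with sum zero. If at most one of the three circles is nondegenerate, the orbit is
    a point or a circle. Otherwise two of the angles determine a point of the torus,
    and the cases are told apart by the rank of the linear map: in rank two the orbit
    is the whole torus, in rank zero a point, and in rank one a circle if the
    direction is rational and else an injective line, which is dense in the torus by
    Kronecker's theorem ([orbit_trichotomy]). *)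

(** * The cross product *)

Notation o7 k := (@Ordinal 7 k isT).
Notation "x .# k" := (x 0%R (o7 k)) (at level 3, k at level 0, format "x .# k").

Lemma ord7_ind (P : 'I_7 -> Prop) :
  P (o7 0) -> P (o7 1) -> P (o7 2) -> P (o7 3) -> P (o7 4) -> P (o7 5) ->
  P (o7 6) -> forall i, P i.
Proof.
move=> p0 p1 p2 p3 p4 p5 p6 [[|[|[|[|[|[|[|//]]]]]]] lti];
  by rewrite (bool_irrelevance lti isT).
Qed.

Lemma sum7 (V : nmodType) (F : 'I_7 -> V) :
  \sum_i F i = F (o7 0) + F (o7 1) + F (o7 2) + F (o7 3) + F (o7 4) + F (o7 5)
               + F (o7 6).
Proof.
rewrite !big_ord_recl big_ord0 addr0 !addrA.
by do !congr (_ + _); congr F; apply: val_inj.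
Qed.

Section ScalarProduct.
Context {R : realType}.

Lemma spC n (u v : 'rV[R]_n) : scalar_prod u v = scalar_prod v u.
Proof. by apply: eq_bigr => i _; rewrite mulrC. Qed.

Lemma sp_mulmx n (u v : 'rV[R]_n) : scalar_prod u v = (u *m v^T) 0 0.
Proof. by rewrite mxE; apply: eq_bigr => i _; rewrite mxE. Qed.

Lemma spDl n (u v w : 'rV[R]_n) :
  scalar_prod (u + v) w = scalar_prod u w + scalar_prod v w.
Proof. by rewrite !sp_mulmx mulmxDl mxE. Qed.

Lemma spZl n (a : R) (u w : 'rV[R]_n) : scalar_prod (a *: u) w = a * scalar_prod u w.
Proof. by rewrite !sp_mulmx -scalemxAl mxE. Qed.

Lemma spDr n (u v w : 'rV[R]_n) :
  scalar_prod w (u + v) = scalar_prod w u + scalar_prod w v.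
Proof. by rewrite spC spDl !(spC w). Qed.

Lemma spZr n (a : R) (u w : 'rV[R]_n) : scalar_prod w (a *: u) = a * scalar_prod w u.
Proof. by rewrite spC spZl (spC w). Qed.

Lemma spNl n (u w : 'rV[R]_n) : scalar_prod (- u) w = - scalar_prod u w.
Proof. by rewrite -scaleN1r spZl mulN1r. Qed.

Lemma spNr n (u w : 'rV[R]_n) : scalar_prod w (- u) = - scalar_prod w u.
Proof. by rewrite spC spNl spC. Qed.

Lemma spBl n (u v w : 'rV[R]_n) :
  scalar_prod (u - v) w = scalar_prod u w - scalar_prod v w.
Proof. by rewrite spDl spNl. Qed.

Lemma spBr n (u v w : 'rV[R]_n) :
  scalar_prod w (u - v) = scalar_prod w u - scalar_prod w v.
Proof. by rewrite spDr spNr. Qed.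

Lemma sp0l n (w : 'rV[R]_n) : scalar_prod 0 w = 0.
Proof. by rewrite -(scale0r 0) spZl mul0r. Qed.

Lemma sp0r n (w : 'rV[R]_n) : scalar_prod w 0 = 0.
Proof. by rewrite spC sp0l. Qed.

Lemma sp_sumr n I (r : seq I) (F : I -> 'rV[R]_n) (w : 'rV[R]_n) :
  scalar_prod w (\sum_(i <- r) F i) = \sum_(i <- r) scalar_prod w (F i).
Proof.
elim/big_rec2: _ => [|i y x _ <-]; first exact: sp0r.
by rewrite spDr.
Qed.

Lemma sp_suml n I (r : seq I) (F : I -> 'rV[R]_n) (w : 'rV[R]_n) :
  scalar_prod (\sum_(i <- r) F i) w = \sum_(i <- r) scalar_prod (F i) w.
Proof. by rewrite spC sp_sumr; apply: eq_bigr => i _; rewrite spC. Qed.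

Lemma sp_ge0 n (u : 'rV[R]_n) : 0 <= scalar_prod u u.
Proof. by apply: sumr_ge0 => i _; rewrite -expr2 sqr_ge0. Qed.

Lemma sp_eq0 n (u : 'rV[R]_n) : scalar_prod u u = 0 -> u = 0.
Proof.
move/eqP; rewrite psumr_eq0 => [/allP u0|i _]; last by rewrite -expr2 sqr_ge0.
apply/rowP => i; rewrite mxE; apply/eqP.
by have := u0 i (mem_index_enum _); rewrite mulf_eq0 orbb.
Qed.

Lemma sp_gt0 n (u : 'rV[R]_n) : u != 0 -> 0 < scalar_prod u u.
Proof.
by move=> u0; rewrite lt0r sp_ge0 andbT; apply: contra_neq u0; exact: sp_eq0.
Qed.

Lemma sp_inj n (u v : 'rV[R]_n) :
  (forall w, scalar_prod u w = scalar_prod v w) -> u = v.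
Proof.
move=> uv; apply/eqP; rewrite -subr_eq0; apply/eqP/sp_eq0.
by rewrite spBl uv subrr.
Qed.

Lemma sp_adj n (A : 'M[R]_n) (u v : 'rV[R]_n) :
  scalar_prod (u *m A) v = scalar_prod u (v *m A^T).
Proof. by rewrite !sp_mulmx trmx_mul trmxK mulmxA. Qed.

End ScalarProduct.

(** The cross product through the structure constants of the octonions; see
    [crossE]. *)
HB.lock Definition cprod (R : realType) (u v : 'rV[R]_7) : 'rV[R]_7 :=
  \row_k \sum_i \sum_j u 0 i * v 0 j * octonion_eps i.+1 j.+1 k.+1.

Section CrossProduct.
Context {R : realType}.
Implicit Types (u v w : 'rV[R]_7) (a b : R).

Lemma cprodE u v (k : 'I_7) :
  cprod u v 0 k = \sum_i \sum_j u 0 i * v 0 j * octonion_eps i.+1 j.+1 k.+1.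
Proof. by rewrite unlock mxE. Qed.

Lemma octonion_ee_scalar (i j : 'I_7) :
  octonion_ee (R := R) (lift 0 i) (lift 0 j) 0 0 = - (i == j)%:R.
Proof.
rewrite /octonion_ee /= !mxE eqxx (inj_eq lift_inj) mulr1.
rewrite summxE big1 ?addr0 // => k k0; rewrite !mxE eqxx /=.
by rewrite eq_sym (negbTE k0) mulr0.
Qed.

Lemma octonion_ee_pure (i j k : 'I_7) :
  octonion_ee (R := R) (lift 0 i) (lift 0 j) 0 (lift 0 k)
  = octonion_eps i.+1 j.+1 k.+1.
Proof.
rewrite /octonion_ee /= !mxE /= mulr0 oppr0 add0r.
rewrite summxE (bigD1 (lift 0 k)) //= !mxE !eqxx mulr1 big1 ?addr0 //.
by move=> l /andP[l0 lk]; rewrite !mxE eqxx /= eq_sym (negbTE lk) mulr0.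
Qed.

Lemma octonion_mulE a b u v :
  octonion_mul (row_mx (const_mx a) u) (row_mx (const_mx b) v)
  = row_mx (const_mx (a * b - scalar_prod u v))
           (a *: v + b *: u + cprod u v).
Proof.
have x0 c w : (row_mx (const_mx c) w : 'rV_(1 + 7)) 0 ord0 = c.
  by rewrite (_ : ord0 = lshift 7 (0 : 'I_1)) ?row_mxEl ?mxE //; apply: val_inj.
have xS c w (i : 'I_7) : (row_mx (const_mx c) w : 'rV_(1 + 7)) 0 (lift ord0 i) = w 0 i.
  by rewrite -rshift1 row_mxEr.
have recl (V : nmodType) (F : 'I_(1 + 7) -> V) :
    \sum_i F i = F ord0 + \sum_(i < 7) F (lift ord0 i) by rewrite big_ord_recl.
have e0k k : octonion_ee (R := R) ord0 k = delta_mx 0 k by [].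
have ek0 (k : 'I_7) : octonion_ee (R := R) (lift ord0 k) ord0 = delta_mx 0 (lift ord0 k) by [].
have dl (F : 'I_7 -> R) (k : 'I_7) : \sum_j F j * (k == j)%:R = F k.
  rewrite (bigD1 k) //= eqxx mulr1 big1 ?addr0 // => j /negbTE.
  by rewrite eq_sym => ->; rewrite mulr0.
apply/rowP => k; rewrite /octonion_mul recl [X in X + _]recl.
under [X in _ + X]eq_bigr do rewrite recl.
rewrite !x0 e0k big_split /=.
under [X in _ + X + _]eq_bigr do rewrite xS e0k.
under [X in _ + (X + _)]eq_bigr do rewrite xS ek0.
under [X in _ + (_ + X)]eq_bigr => i _.
  under eq_bigr do rewrite !xS.
  over.
case: (unliftP ord0 k) => [l|] ->; rewrite ?xS ?x0 /= !mxE ?cprodE !summxE.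
  rewrite eqxx /= mulr0 add0r addrA.
  under eq_bigr do rewrite !mxE eqxx (inj_eq lift_inj).
  rewrite dl; congr (_ + _ + _).
    by under eq_bigr do rewrite !mxE eqxx (inj_eq lift_inj); rewrite dl mulrC.
  apply: eq_bigr => i _; rewrite summxE; apply: eq_bigr => j _.
  by rewrite mxE octonion_ee_pure.
rewrite !eqxx mulr1 -addrA; congr (_ + _).
do 2![rewrite big1 ?add0r; last by move=> i _; rewrite !mxE mulr0].
rewrite /scalar_prod -sumrN; apply: eq_bigr => i _.
rewrite summxE -mulrN -(dl (fun j => v 0 j)) -sumrN mulr_sumr.
by apply: eq_bigr => j _; rewrite mxE octonion_ee_scalar !mulrN mulrA.
Qed.

Lemma octonion_epsC i j k : octonion_eps (R := R) j i k = - octonion_eps i j k.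
Proof. by rewrite /octonion_eps opprB. Qed.

Lemma cprodC u v : cprod u v = - cprod v u.
Proof.
apply/rowP => k; rewrite !mxE !cprodE exchange_big -sumrN; apply: eq_bigr => i _.
rewrite -sumrN; apply: eq_bigr => j _.
by rewrite octonion_epsC mulrN (mulrC (u 0 j)).
Qed.

Lemma octonion_mul_im u v :
  octonion_mul (octonion_im u) (octonion_im v)
  = row_mx (const_mx (- scalar_prod u v)) (cprod u v).
Proof.
have im0 w : octonion_im w = row_mx (const_mx 0) w.
  by congr row_mx; apply/rowP=> i; rewrite !mxE.
by rewrite !im0 octonion_mulE mulr0 !scale0r !add0r.
Qed.

Lemma crossE u v : cross u v = cprod u v.
Proof.
rewrite /cross !octonion_mul_im [scalar_prod v u]spC.
rewrite opp_row_mx add_row_mx scale_row_mx row_mxKr.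
rewrite [cprod v u]cprodC opprK.
by rewrite scalerDr -scalerDl (_ : 2^-1 + 2^-1 = 1) ?scale1r //; field.
Qed.

Lemma cprod_coords u v :
  [/\ cprod u v 0 (o7 0) = u.#1 * v.#2 - u.#2 * v.#1 + u.#3 * v.#4 -
      u.#4 * v.#3 + u.#5 * v.#6 - u.#6 * v.#5,
      cprod u v 0 (o7 1) = u.#2 * v.#0 - u.#0 * v.#2 + u.#3 * v.#5 -
      u.#5 * v.#3 + u.#6 * v.#4 - u.#4 * v.#6,
      cprod u v 0 (o7 2) = u.#0 * v.#1 - u.#1 * v.#0 + u.#6 * v.#3 -
      u.#3 * v.#6 + u.#5 * v.#4 - u.#4 * v.#5,
      cprod u v 0 (o7 3) = u.#4 * v.#0 - u.#0 * v.#4 + u.#5 * v.#1 -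
      u.#1 * v.#5 + u.#2 * v.#6 - u.#6 * v.#2
    & [/\ cprod u v 0 (o7 4) = u.#0 * v.#3 - u.#3 * v.#0 + u.#1 * v.#6 -
      u.#6 * v.#1 + u.#2 * v.#5 - u.#5 * v.#2,
      cprod u v 0 (o7 5) = u.#6 * v.#0 - u.#0 * v.#6 + u.#1 * v.#3 -
      u.#3 * v.#1 + u.#4 * v.#2 - u.#2 * v.#4
    & cprod u v 0 (o7 6) = u.#0 * v.#5 - u.#5 * v.#0 + u.#4 * v.#1 -
      u.#1 * v.#4 + u.#3 * v.#2 - u.#2 * v.#3]].
Proof.
split; last split;
  rewrite cprodE sum7 !sum7 /octonion_eps /= ?mulr1n ?mulr0n; ring.
Qed.

Lemma cprodDl u v w : cprod (u + v) w = cprod u w + cprod v w.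
Proof.
apply/rowP => k; rewrite !mxE !cprodE -big_split; apply: eq_bigr => i _.
by rewrite -big_split; apply: eq_bigr => j _; rewrite mxE !mulrDl.
Qed.

Lemma cprodZl a u w : cprod (a *: u) w = a *: cprod u w.
Proof.
apply/rowP => k; rewrite !mxE !cprodE mulr_sumr; apply: eq_bigr => i _.
by rewrite mulr_sumr; apply: eq_bigr => j _; rewrite mxE !mulrA.
Qed.

Lemma cprodDr u v w : cprod w (u + v) = cprod w u + cprod w v.
Proof. by rewrite cprodC cprodDl opprD -!cprodC. Qed.

Lemma cprodZr a u w : cprod w (a *: u) = a *: cprod w u.
Proof. by rewrite cprodC cprodZl -scalerN -cprodC. Qed.

Lemma cprodNl u w : cprod (- u) w = - cprod u w.
Proof. by rewrite -scaleN1r cprodZl scaleN1r. Qed.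

Lemma cprodNr u w : cprod w (- u) = - cprod w u.
Proof. by rewrite -scaleN1r cprodZr scaleN1r. Qed.

Lemma sp_cprod_cyc u v w :
  scalar_prod (cprod u v) w = scalar_prod (cprod v w) u.
Proof.
rewrite /scalar_prod !sum7.
have [-> -> -> -> [-> -> ->]] := cprod_coords u v.
have [-> -> -> -> [-> -> ->]] := cprod_coords v w.
ring.
Qed.

(** The alternative law [u (u w) = (u u) w] of the octonions, restricted to
    imaginary octonions. *)
Lemma cprod_cprodE u w :
  cprod u (cprod u w) = scalar_prod u w *: u - scalar_prod u u *: w.
Proof.
apply/rowP; rewrite /scalar_prod !sum7.
have [w0 w1 w2 w3 [w4 w5 w6]] := cprod_coords u w.
have [v0 v1 v2 v3 [v4 v5 v6]] := cprod_coords u (cprod u w).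
apply: ord7_ind; rewrite ?(v0, v1, v2, v3, v4, v5, v6);
  rewrite ?(w0, w1, w2, w3, w4, w5, w6) !mxE; ring.
Qed.

Lemma cprodvv u : cprod u u = 0.
Proof.
by have := cprodC u u => /eqP; rewrite -addr_eq0 -mulr2n -scaler_nat scaler_eq0
  pnatr_eq0 => /eqP.
Qed.

Lemma sp_cprod_l u v : scalar_prod (cprod u v) u = 0.
Proof. by rewrite -sp_cprod_cyc cprodvv sp0l. Qed.

Lemma sp_cprod_r u v : scalar_prod (cprod u v) v = 0.
Proof. by rewrite sp_cprod_cyc cprodvv sp0l. Qed.

Lemma sp_cprod_skew u v w :
  scalar_prod (cprod u v) w = - scalar_prod v (cprod u w).
Proof. by rewrite sp_cprod_cyc sp_cprod_cyc cprodC spNl spC. Qed.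

(** Linearising [cprod_cprodE] in its first argument. *)
Lemma cprod_cprod_swap u v w :
  cprod u (cprod v w) = scalar_prod u w *: v + scalar_prod v w *: u
    - (2 * scalar_prod u v) *: w - cprod v (cprod u w).
Proof.
have := cprod_cprodE (u + v) w.
rewrite !cprodDl !cprodDr !cprod_cprodE !spDl !spDr (spC v u).
set X := cprod u _; set Y := cprod v _ => E; apply/rowP => i.
by have := congr1 (fun x : 'rV_7 => x 0 i) E; rewrite !mxE; lra.
Qed.

Lemma sp_cprod_cprod u v w : scalar_prod (cprod u v) (cprod u w)
  = scalar_prod u u * scalar_prod v w - scalar_prod u v * scalar_prod u w.
Proof.
rewrite sp_cprod_skew cprod_cprodE spBr !spZr (spC v u); ring.
Qed.

End CrossProduct.

(** * Basic triples *)

Section BasicTriples.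
Context {R : realType}.
Implicit Types (u v w a b c : 'rV[R]_7).

(** By [frame_G2], these are the images of [e_1, e_2, e_4] under [G2]. *)
Definition basic_triple a b c : Prop :=
  [/\ scalar_prod a a = 1, scalar_prod b b = 1 & scalar_prod c c = 1] /\
  [/\ scalar_prod a b = 0, scalar_prod a c = 0, scalar_prod b c = 0
    & scalar_prod (cprod a b) c = 0].

(** Ordered so that the standard basis is the frame of [e_1, e_2, e_4]. *)
Definition frame a b c : 'M[R]_7 :=
  \matrix_(i < 7) nth 0 [:: a; b; cprod a b; c; cprod a c; cprod b c;
                           cprod a (cprod b c)] i.

Lemma cprod_sq u w : scalar_prod u u = 1 -> scalar_prod u w = 0 ->
  cprod u (cprod u w) = - w.
Proof. by move=> u1 uw; rewrite cprod_cprodE u1 uw scale0r scale1r sub0r. Qed.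

Lemma cprod_sqV u w : scalar_prod u u = 1 -> scalar_prod u w = 0 ->
  cprod u (cprod w u) = w.
Proof. by move=> u1 uw; rewrite (cprodC w) cprodNr cprod_sq ?opprK. Qed.

Lemma cprod_swap u v w : scalar_prod u v = 0 -> scalar_prod u w = 0 ->
  scalar_prod v w = 0 -> cprod u (cprod v w) = - cprod v (cprod u w).
Proof.
by move=> uv uw vw; rewrite cprod_cprod_swap uv uw vw mulr0 !scale0r addr0 subr0 sub0r.
Qed.

Section Frame.
Variables a b c : 'rV[R]_7.
Hypothesis abc : basic_triple a b c.

Let d := cprod a b.
Let e := cprod a c.
Let g := cprod b c.
Let h := cprod a g.

Lemma frame_orthonormal : frame a b c *m (frame a b c)^T = 1%:M.
Proof.
case: abc => [[aa bb cc] [ab ac bc dc]].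
have ad : scalar_prod a d = 0 by rewrite spC sp_cprod_l.
have bd : scalar_prod b d = 0 by rewrite spC sp_cprod_r.
have cd : scalar_prod c d = 0 by rewrite spC.
have ae : scalar_prod a e = 0 by rewrite spC sp_cprod_l.
have ce : scalar_prod c e = 0 by rewrite spC sp_cprod_r.
have be : scalar_prod b e = 0.
  by rewrite -[LHS]opprK -sp_cprod_skew dc oppr0.
have bg : scalar_prod b g = 0 by rewrite spC sp_cprod_l.
have cg : scalar_prod c g = 0 by rewrite spC sp_cprod_r.
have ag : scalar_prod a g = 0 by rewrite spC -sp_cprod_cyc.
have de : scalar_prod d e = 0 by rewrite sp_cprod_cprod aa bc ab; ring.
have dg : scalar_prod d g = 0.
  by rewrite /d cprodC spNl sp_cprod_cprod ac bc bb (spC b) ab; ring.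
have eg : scalar_prod e g = 0.
  rewrite /e /g cprodC (cprodC _ c) spNl spNr sp_cprod_cprod ab (spC c) ac; ring.
have ah : scalar_prod a h = 0 by rewrite spC sp_cprod_l.
have gh : scalar_prod g h = 0 by rewrite spC sp_cprod_r.
have bh : scalar_prod b h = 0.
  by rewrite spC /h sp_cprod_cyc (cprodC g) /g cprod_sq // opprK spC.
have ch : scalar_prod c h = 0.
  rewrite spC /h sp_cprod_cyc (cprodC g) /g (cprodC b) cprodNr.
  by rewrite cprod_sq ?(spC c) // opprK spNl spC ab oppr0.
have dh : scalar_prod d h = 0 by rewrite sp_cprod_cprod aa bg ab; ring.
have eh : scalar_prod e h = 0 by rewrite sp_cprod_cprod aa cg ac; ring.
have dd : scalar_prod d d = 1 by rewrite sp_cprod_cprod aa bb ab; ring.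
have ee : scalar_prod e e = 1 by rewrite sp_cprod_cprod aa cc ac; ring.
have gg : scalar_prod g g = 1 by rewrite sp_cprod_cprod bb cc bc; ring.
have hh : scalar_prod h h = 1 by rewrite sp_cprod_cprod aa gg ag; ring.
have E (i j : 'I_7) : scalar_prod (row i (frame a b c)) (row j (frame a b c))
    = (i == j)%:R.
  rewrite !rowK; move: i j; apply: ord7_ind; apply: ord7_ind => /=;
  by rewrite -/d -/e -/g -/h // spC.
apply/matrixP => i j; rewrite !mxE -E; apply: eq_bigr => k _.
by rewrite !mxE.
Qed.

(** The multiplication table of a basic triple is forced: every product of frame
    vectors reduces, by [cprod_sq], [cprod_sqV] and [cprod_swap], to a signed frame
    vector, and the signs are those of the standard basis. *)
Lemma frame_cprod (i j : 'I_7) :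
  cprod (row i (frame a b c)) (row j (frame a b c))
  = \sum_(k < 7) octonion_eps i.+1 j.+1 k.+1 *: row k (frame a b c).
Proof.
case: abc => [[aa bb cc] [ab ac bc dc]].
have ad : scalar_prod a d = 0 by rewrite spC sp_cprod_l.
have bd : scalar_prod b d = 0 by rewrite spC sp_cprod_r.
have cd : scalar_prod c d = 0 by rewrite spC.
have ae : scalar_prod a e = 0 by rewrite spC sp_cprod_l.
have ce : scalar_prod c e = 0 by rewrite spC sp_cprod_r.
have be : scalar_prod b e = 0.
  by rewrite -[LHS]opprK -sp_cprod_skew dc oppr0.
have ag : scalar_prod a g = 0 by rewrite spC -sp_cprod_cyc.
have dd : scalar_prod d d = 1 by rewrite sp_cprod_cprod aa bb ab; ring.
have ee : scalar_prod e e = 1 by rewrite sp_cprod_cprod aa cc ac; ring.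
have gg : scalar_prod g g = 1 by rewrite sp_cprod_cprod bb cc bc; ring.
have Pab : cprod a b = d by [].
have Pac : cprod a c = e by [].
have Pbc : cprod b c = g by [].
have Pag : cprod a g = h by [].
have Pad : cprod a d = - b by rewrite cprod_sq.
have Pae : cprod a e = - c by rewrite cprod_sq.
have Pah : cprod a h = - g by rewrite cprod_sq.
have Pbd : cprod b d = a by rewrite cprod_sqV // spC.
have Pbe : cprod b e = - h by rewrite cprod_swap // spC.
have Pbg : cprod b g = - c by rewrite cprod_sq.
have Pbh : cprod b h = e by rewrite -[h]opprK -Pbe cprodNr cprod_sq ?opprK.
have Pcd : cprod c d = h.
  by rewrite cprod_swap ?(spC c) // (cprodC c) cprodNr opprK.
have Pdc : cprod d c = - h by rewrite cprodC Pcd.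
have Pde : cprod d e = - g.
  by rewrite cprod_swap ?(spC d) // Pdc cprodNr Pah opprK.
have Pdg : cprod d g = e.
  by rewrite cprod_swap ?(spC d) // Pdc cprodNr Pbh opprK.
have Pdh : cprod d h = c by rewrite -Pcd cprod_sqV // spC.
have Pce : cprod c e = a by rewrite cprod_sqV // spC.
have Pcg : cprod c g = b by rewrite cprod_sqV // spC.
have Pch : cprod c h = - d by rewrite -Pcd cprod_sq.
have Peg : cprod e g = - d.
  by rewrite cprod_swap ?(spC e) // (cprodC e) Pce cprodNr opprK cprodC.
have Pehb : h = cprod e b by rewrite cprodC Pbe opprK.
have Peh : cprod e h = - b by rewrite Pehb cprod_sq // spC.
have Pgh : cprod g h = a by rewrite cprod_sqV // spC.
clear Pehb.
rewrite sum7 !rowK; move: i j; apply: ord7_ind; apply: ord7_ind => /=;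
rewrite -/d -/e -/g -/h /octonion_eps /= ?(mulr1n, mulr0n, subr0, sub0r, subrr);
rewrite !(scale0r, scale1r, scaleN1r, addr0, add0r) ?cprodvv //;
first [ done | by rewrite cprodC ?(Pab, Pac, Pbc, Pag, Pad, Pae, Pah, Pbd, Pbe,
  Pbg, Pbh, Pcd, Pde, Pdg, Pdh, Pce, Pcg, Pch, Peg, Peh, Pgh) ?opprK ].
Qed.
End Frame.
End BasicTriples.

(** * The group G2 and its basic triples *)

Section G2.
Context {R : realType}.
Implicit Types (u v w a b c : 'rV[R]_7).

Lemma cprod0l w : cprod 0 w = 0.
Proof. by have := cprodZl 0 0 w; rewrite !scale0r. Qed.

Lemma cprod0r w : cprod w 0 = 0.
Proof. by rewrite cprodC cprod0l oppr0. Qed.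

Lemma cprod_suml I (r : seq I) (F : I -> 'rV[R]_7) w :
  cprod (\sum_(i <- r) F i) w = \sum_(i <- r) cprod (F i) w.
Proof.
elim/big_rec2: _ => [|i y x _ <-]; last by rewrite cprodDl.
exact: cprod0l.
Qed.

Lemma cprod_sumr I (r : seq I) (F : I -> 'rV[R]_7) w :
  cprod w (\sum_(i <- r) F i) = \sum_(i <- r) cprod w (F i).
Proof.
rewrite cprodC cprod_suml -sumrN; apply: eq_bigr => i _.
by rewrite -cprodC.
Qed.

Lemma rowvec_const (p : 'rV[R]_1) : p = const_mx (p 0 0).
Proof. by apply/rowP => i; rewrite mxE !ord1. Qed.

(** An automorphism fixes the unit, hence preserves separately the real part
    (the scalar product) and the imaginary part (the cross product) of a product
    of imaginary octonions. *)
Lemma G2_preserves g : G2 R g -> forall u v,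
  scalar_prod (u *m g^T) (v *m g^T) = scalar_prod u v /\
  cprod (u *m g^T) (v *m g^T) = cprod u v *m g^T.
Proof.
case=> f [[flin [finv fK finvK] fM] fg] u v.
pose e : octonion R := row_mx (const_mx 1) 0.
have mul1 x : octonion_mul e x = x.
  rewrite -[x](@hsubmxK _ 1 1 7) (rowvec_const (lsubmx x)) octonion_mulE.
  by rewrite sp0l scaler0 scale1r subr0 mul1r addr0 cprod0l addr0.
have mulr1' x : octonion_mul x e = x.
  rewrite -[x](@hsubmxK _ 1 1 7) (rowvec_const (lsubmx x)) octonion_mulE.
  by rewrite sp0r scaler0 scale1r subr0 mulr1 add0r cprod0r addr0.
have fe : f e = e.
  by rewrite -[LHS]mulr1' -[X in octonion_mul _ X]finvK -fM mul1 finvK.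
have fD x y (k : R) : f (k *: x + y) = k *: f x + f y by exact: flin.
have := fM (octonion_im u) (octonion_im v).
rewrite !fg !octonion_mul_im.
have -> : row_mx (const_mx (- scalar_prod u v)) (cprod u v)
        = (- scalar_prod u v) *: e + octonion_im (cprod u v).
  rewrite scale_row_mx add_row_mx scaler0 add0r; congr row_mx.
  by apply/rowP => i; rewrite !mxE mulr1 addr0.
rewrite fD fe fg /octonion_im scale_row_mx add_row_mx scaler0 add0r addr0.
move/eq_row_mx => [/rowP/(_ 0) + <-]; rewrite !mxE mulr1 => /oppr_inj ->.
by [].
Qed.

Lemma frame_tr_orthonormal a b c : basic_triple a b c ->
  (frame a b c)^T *m frame a b c = 1%:M.
Proof. by move=> abc; apply: mulmx1C; exact: frame_orthonormal. Qed.

(** [G2] acts transitively on basic triples: the matrix whose rows are the frame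
    of a basic triple has the same multiplication table as the standard basis. *)
Lemma frame_G2 a b c : basic_triple a b c -> G2 R (frame a b c)^T.
Proof.
move=> abc; set F := frame a b c.
have FF : F *m F^T = 1%:M by exact: frame_orthonormal.
have FtF : F^T *m F = 1%:M by exact: frame_tr_orthonormal.
have spF u v : scalar_prod (u *m F) (v *m F) = scalar_prod u v.
  by rewrite sp_adj -mulmxA FF mulmx1.
have cpF u v : cprod (u *m F) (v *m F) = cprod u v *m F.
  rewrite !mulmx_sum_row cprod_suml.
  under eq_bigr => i _.
    rewrite cprod_sumr.
    under eq_bigr do rewrite cprodZl cprodZr frame_cprod // scaler_sumr scaler_sumr.
    over.
  under [RHS]eq_bigr => k _ do rewrite cprodE scaler_suml.
  rewrite [RHS]exchange_big; apply: eq_bigr => i _ /=.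
  under [RHS]eq_bigr => k _ do rewrite scaler_suml.
  rewrite [RHS]exchange_big; apply: eq_bigr => j _ /=.
  by apply: eq_bigr => k _; rewrite !scalerA.
pose B : 'M[R]_(1 + 7) := block_mx 1%:M 0 0 F.
have mulB (p : 'rV_1) u : row_mx p u *m B = row_mx p (u *m F).
  by rewrite mul_row_block !mulmx0 mulmx1 addr0 add0r.
exists (fun x => x *m B); split; last first.
  by move=> v; rewrite /octonion_im mulB trmxK.
split.
- by move=> a' x y; rewrite mulmxDl -scalemxAl.
- exists (fun x => x *m block_mx 1%:M 0 0 F^T) => x.
    rewrite -mulmxA mulmx_block !mulmx0 !mul0mx FF !mulmx1 !addr0 add0r.
    by rewrite -scalar_mx_block mulmx1.
  rewrite -mulmxA mulmx_block !mulmx0 !mul0mx FtF !mulmx1 !addr0 add0r.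
  by rewrite -scalar_mx_block mulmx1.
- move=> x y; rewrite -[x](@hsubmxK _ 1 1 7) -[y](@hsubmxK _ 1 1 7).
  rewrite (rowvec_const (lsubmx x)) (rowvec_const (lsubmx y)).
  by rewrite octonion_mulE !mulB octonion_mulE spF cpF !mulmxDl -!scalemxAl.
Qed.

End G2.

(** * Invariant two-forms on the sphere *)

Section RowPairs.
Context {R : realType} {n : nat}.
Implicit Types u v : 'rV[R]_n.

Lemma row_id (u : 'rV[R]_n) : row 0 u = u.
Proof. by apply/rowP => i; rewrite mxE. Qed.

Lemma row0_pair u v : row (0 : 'I_2) (col_mx u v) = u.
Proof.
have -> : (0 : 'I_2) = lshift 1 (0 : 'I_1) by exact: val_inj.
exact: etrans (rowKu 0 u v) (row_id u).
Qed.

Lemma row1_pair u v : row (1 : 'I_2) (col_mx u v) = v.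
Proof.
have -> : (1 : 'I_2) = rshift 1 (0 : 'I_1) by exact: val_inj.
exact: etrans (rowKd 0 u v) (row_id v).
Qed.

Lemma row'_pair (i : 'I_2) u v :
  row' i (col_mx u v) = if i == 0 then v else u :> 'rV_n.
Proof.
apply/rowP => j; rewrite [LHS]mxE; case: i => [[|[|//]]] lti.
  have -> : lift (Ordinal lti) (0 : 'I_1) = rshift 1 (0 : 'I_1) by exact: val_inj.
  exact: col_mxEd.
have -> : lift (Ordinal lti) (0 : 'I_1) = lshift 1 (0 : 'I_1) by exact: val_inj.
exact: col_mxEu.
Qed.

Lemma mul_pair m (M : 'M[R]_(n, m)) u v :
  (col_mx u v : 'M[R]_(2, n)) *m M = col_mx (u *m M) (v *m M) :> 'M[R]_(2, m).
Proof. exact: (mul_col_mx u v M). Qed.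

Lemma ord2_ind (P : 'I_2 -> Prop) : P 0 -> P 1 -> forall i, P i.
Proof.
move=> p0 p1 [[|[|//]]] lti.
  by rewrite (_ : Ordinal lti = 0) //; apply: val_inj.
by rewrite (_ : Ordinal lti = 1) //; apply: val_inj.
Qed.

Lemma ord3_ind (P : 'I_3 -> Prop) : P 0 -> P 1 -> P ord_max -> forall i, P i.
Proof.
move=> p0 p1 p2 [[|[|[|//]]]] lti.
- by rewrite (_ : Ordinal lti = 0) //; apply: val_inj.
- by rewrite (_ : Ordinal lti = 1) //; apply: val_inj.
- by rewrite (_ : Ordinal lti = ord_max) //; apply: val_inj.
Qed.

End RowPairs.

Section InvariantForms.
Context {R : realType}.
Implicit Types (a b c p u v w : 'rV[R]_7).

Lemma tangent1 p v : tangent p v <-> scalar_prod v p = 0.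
Proof.
split=> [/(_ 0)|vp i]; first by rewrite row_id.
by rewrite ord1 row_id.
Qed.

Lemma tangent2 p u v :
  tangent p (col_mx u v) <-> scalar_prod u p = 0 /\ scalar_prod v p = 0.
Proof.
split=> [T|[up vp]]; last by apply: ord2_ind; rewrite ?row0_pair ?row1_pair.
by split; [have := T 0; rewrite row0_pair|have := T 1; rewrite row1_pair].
Qed.

Section Alternating.
Variables (p : 'rV[R]_7) (al : 'M[R]_(2, 7) -> R).
Hypothesis al_alt : alternating_at p al.
Let T v := scalar_prod v p = 0.

Lemma alternating_linl (x y : R) u u' v : T u -> T u' -> T v ->
  al (col_mx (x *: u + y *: u') v)
  = x * al (col_mx u v) + y * al (col_mx u' v).
Proof.
move=> Tu Tu' Tv; apply: (al_alt.1 0); rewrite ?row0_pair ?row'_pair //;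
  apply/tangent2 => //.
by split=> //; rewrite spDl !spZl Tu Tu' !mulr0 addr0.
Qed.

Lemma alternating_linr (x y : R) u v v' : T u -> T v -> T v' ->
  al (col_mx u (x *: v + y *: v'))
  = x * al (col_mx u v) + y * al (col_mx u v').
Proof.
move=> Tu Tv Tv'; apply: (al_alt.1 1); rewrite ?row1_pair ?row'_pair //;
  apply/tangent2 => //.
by split=> //; rewrite spDl !spZl Tv Tv' !mulr0 addr0.
Qed.

Lemma alternatingvv u : T u -> al (col_mx u u) = 0.
Proof.
move=> Tu; apply: (al_alt.2 0 1) => //; first exact/tangent2.
by rewrite row0_pair row1_pair.
Qed.

Lemma alternating_sum (I J : Type) (r : seq I) (s : seq J) (x : I -> R)
    (y : J -> R) (F : I -> 'rV[R]_7) (G : J -> 'rV[R]_7) :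
  (forall i, T (F i)) -> (forall j, T (G j)) ->
  al (col_mx (\sum_(i <- r) x i *: F i) (\sum_(j <- s) y j *: G j))
  = \sum_(i <- r) \sum_(j <- s) x i * y j * al (col_mx (F i) (G j)).
Proof.
move=> TF TG.
have T0 : T 0 by rewrite /T sp0l.
have TS K (t : seq K) (k : K -> R) (H : K -> 'rV[R]_7) :
    (forall i, T (H i)) -> T (\sum_(i <- t) k i *: H i).
  by move=> TH; rewrite /T sp_suml big1 // => i _; rewrite spZl TH mulr0.
elim: r => [|i r IH].
  rewrite !big_nil.
  have := alternating_linl 0 0 T0 T0 (TS _ s y G TG).
  by rewrite !scale0r addr0 !mul0r addr0.
rewrite !big_cons -[X in _ + X]scale1r alternating_linl;
  [|exact: TF|exact: TS|exact: TS].
rewrite mul1r IH; congr (_ + _).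
under [RHS]eq_bigr do rewrite -mulrA.
rewrite -mulr_sumr; congr (_ * _); elim: s {IH} => [|j s IH].
  rewrite !big_nil.
  have := alternating_linr 0 0 (TF i) T0 T0.
  by rewrite !scale0r addr0 !mul0r addr0.
rewrite !big_cons -[X in _ + X]scale1r alternating_linr;
  [|exact: TF|exact: TG|exact: TS].
by rewrite mul1r IH.
Qed.

End Alternating.

Lemma exists_orthogonal (k : nat) (U : 'M[R]_(k, 7)) : (k < 7)%N ->
  exists v : 'rV[R]_7, scalar_prod v v = 1 /\
    forall i, scalar_prod v (row i U) = 0.
Proof.
move=> k7; have /rowV0Pn[w /sub_kermxP wU w0] : kermx U^T != 0.
  rewrite -mxrank_eq0 mxrank_ker subn_eq0 -ltnNge.
  exact: leq_ltn_trans (rank_leq_col _) k7.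
have sw : 0 < Num.sqrt (scalar_prod w w) by rewrite sqrtr_gt0 sp_gt0.
exists ((Num.sqrt (scalar_prod w w))^-1 *: w); split.
  rewrite spZl spZr -[X in _ * (_ * X)]sqr_sqrtr ?sp_ge0 //.
  by field; rewrite gt_eqF.
move=> i; rewrite spZl; have /rowP/(_ i) := wU; rewrite !mxE => E.
have -> : scalar_prod w (row i U) = 0; last by rewrite mulr0.
by rewrite -[RHS]E; apply: eq_bigr => j _; rewrite !mxE.
Qed.

Lemma basic_triple_extend a b : scalar_prod a a = 1 -> scalar_prod b b = 1 ->
  scalar_prod a b = 0 -> exists c, basic_triple a b c.
Proof.
move=> aa bb ab.
have [c [cc cU]] := @exists_orthogonal 3
  (\matrix_(i < 3) nth 0 [:: a; b; cprod a b] i) isT.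
exists c; split; split=> //; rewrite spC.
- by have := cU 0; rewrite rowK.
- by have := cU 1; rewrite rowK.
- by have := cU ord_max; rewrite rowK.
Qed.

Lemma frame_rows a b c :
  [/\ row (o7 0) (frame a b c) = a, row (o7 1) (frame a b c) = b,
      row (o7 2) (frame a b c) = cprod a b & row (o7 3) (frame a b c) = c].
Proof. by split; rewrite rowK. Qed.

(** The [G2]-invariant two-forms on the sphere are the multiples of the Kaehler
    form [<p x u, v>] of the almost complex structure [u |-> p x u]: two basic
    triples are related by [G2], and so are [(p, u, v)] and [(p, u, -v)], so that
    an invariant form vanishes on [(u, v)] when [p, u, v] is a basic triple, and
    takes the same value on all [(u, p x u)]. *)
Lemma invariant_two_form (theta : dform R 2 7) :
  (forall p, sphere R p -> alternating_at p (theta p)) -> G2_invariant theta ->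
  exists k : R, forall p u v, sphere R p ->
    scalar_prod u p = 0 -> scalar_prod v p = 0 ->
    theta p (col_mx u v) = k * scalar_prod (cprod p u) v.
Proof.
move=> alt inv.
pose e (i : 'I_7) : 'rV[R]_7 := delta_mx 0 i.
have se i : sphere R (e i).
  rewrite /sphere /= /scalar_prod (bigD1 i) //= !mxE !eqxx mulr1.
  by rewrite big1 ?addr0 // => j ji; rewrite !mxE (negbTE ji) mulr0.
have eo i j : i != j -> scalar_prod (e i) (e j) = 0.
  move=> ij; rewrite /scalar_prod big1 // => l _; rewrite !mxE /=.
  by case: (eqVneq l i) => [->|_]; rewrite ?(negbTE ij) ?mulr0 ?mul0r.
have move_to a b c : basic_triple a b c ->
    theta a (col_mx b c) = theta (e (o7 0)) (col_mx (e (o7 1)) (e (o7 3))) /\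
    theta a (col_mx b (cprod a b))
    = theta (e (o7 0)) (col_mx (e (o7 1)) (e (o7 2))).
  move=> abc; have G := frame_G2 abc.
  have [r0 r1 r2 r3] := frame_rows a b c.
  have E i j : o7 0 != i -> o7 0 != j ->
      theta a (col_mx (row i (frame a b c)) (row j (frame a b c)))
      = theta (e (o7 0)) (col_mx (e i) (e j)).
    move=> i0 j0; have Tij : tangent (e (o7 0)) (col_mx (e i) (e j)).
      by apply/tangent2; rewrite !eo // eq_sym.
    have := inv _ G _ (se (o7 0)) _ Tij.
    by rewrite trmxK -rowE r0 mul_pair -!rowE.
  by split; rewrite -E // ?r1 ?r2 ?r3.
exists (theta (e (o7 0)) (col_mx (e (o7 1)) (e (o7 2)))).
(* The basic triples (a, b, c) and (a, b, -c) give the same value. *)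
have anti a b c : basic_triple a b c -> theta a (col_mx b c) = 0.
  move=> abc; have abNc : basic_triple a b (- c).
    by case: abc => [[? ? cc] [? ac bc dc]]; split; split; rewrite ?spNl ?spNr
      ?cc ?ac ?bc ?dc ?opprK ?oppr0.
  have [E _] := move_to _ _ _ abc; have [E' _] := move_to _ _ _ abNc.
  case: abc => [[aa _ _] [ab ac _ _]].
  have := alternating_linr (alt a aa) (-1) 0 (u := b) (v := c) (v' := c).
  rewrite ![scalar_prod _ a]spC => /(_ ab ac ac).
  rewrite scaleN1r scale0r addr0 mulN1r mul0r addr0 E' E => /eqP.
  by rewrite -addr_eq0 -mulr2n -scaler_nat scaler_eq0 pnatr_eq0 => /eqP.
have normalize w : w != 0 -> exists2 w1, scalar_prod w1 w1 = 1 &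
    exists2 r, w = r *: w1 & w1 = r^-1 *: w.
  move=> w0; pose r := Num.sqrt (scalar_prod w w).
  have r0 : r != 0 by rewrite gt_eqF // sqrtr_gt0 sp_gt0.
  have rr : r * r = scalar_prod w w by rewrite -expr2 sqr_sqrtr ?sp_ge0.
  exists (r^-1 *: w); first by rewrite spZl spZr -rr; field.
  by exists r; rewrite // scalerA divff ?scale1r.
have unit_case p u v : sphere R p -> scalar_prod u u = 1 ->
    scalar_prod u p = 0 -> scalar_prod v p = 0 ->
    theta p (col_mx u v)
    = theta (e (o7 0)) (col_mx (e (o7 1)) (e (o7 2))) * scalar_prod (cprod p u) v.
  move=> pp uu up vp.
  have [c puc] := basic_triple_extend pp uu (etrans (spC _ _) up).
  have [_ Epu] := move_to _ _ _ puc.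
  have Tpu : scalar_prod (cprod p u) p = 0 by exact: sp_cprod_l.
  have pu1 : scalar_prod (cprod p u) (cprod p u) = 1.
    by rewrite sp_cprod_cprod pp uu (spC p) up; ring.
  (* If nonzero, w completes p and u to a basic triple after normalisation. *)
  pose w := v - scalar_prod (cprod p u) v *: cprod p u - scalar_prod u v *: u.
  have wp : scalar_prod w p = 0 by rewrite !spBl !spZl vp up Tpu; ring.
  have wu : scalar_prod u w = 0.
    by rewrite !spBr !spZr uu (spC u (cprod _ _)) sp_cprod_r; ring.
  have wpu : scalar_prod (cprod p u) w = 0.
    by rewrite !spBr !spZr pu1 sp_cprod_r; ring.
  have -> : v = 1 *: (1 *: w + scalar_prod u v *: u)
      + scalar_prod (cprod p u) v *: cprod p u.
    by rewrite !scale1r /w !subrK.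
  have Tw : scalar_prod (1 *: w + scalar_prod u v *: u) p = 0.
    by rewrite spDl !spZl wp up; ring.
  rewrite !(alternating_linr (alt p pp)) // Epu (alternatingvv (alt p pp)) //.
  have -> : theta p (col_mx u w) = 0.
    have [w0|/normalize[w1 w11 [r wr w1r]]] := eqVneq w 0.
      have := alternating_linr (alt p pp) 0 0 up up up.
      by rewrite w0 !scale0r addr0 !mul0r addr0.
    have puw1 : basic_triple p u w1.
      by split; split=> //; rewrite ?w1r ?spZr ?wu ?wpu ?(spC p) ?wp ?mulr0.
    have := alternating_linr (alt p pp) r 0 (u := u) (v := w1) (v' := u).
    rewrite scale0r addr0 -wr => -> //; last by rewrite w1r spZl wp mulr0.
    by rewrite anti // mulr0 mul0r addr0.
  rewrite scale1r !spDr !spZr wpu sp_cprod_r pu1; ring.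
move=> p u v pp up vp; have [u0|/normalize[u1 u11 [r ur u1r]]] := eqVneq u 0.
  have := alternating_linl (alt p pp) 0 0 vp vp vp.
  by rewrite u0 !scale0r addr0 !mul0r addr0 cprod0r sp0l mulr0.
have u1p : scalar_prod u1 p = 0 by rewrite u1r spZl up mulr0.
have := alternating_linl (alt p pp) r 0 u1p vp vp.
rewrite scale0r addr0 -ur => ->; rewrite unit_case // ur cprodZr spZl; ring.
Qed.

End InvariantForms.

(** * Derivatives of vector-valued maps *)

Section Derivatives.
Context {R : realType} {V : normedModType R}.
Implicit Types (x v : V).

Lemma is_derive_mx m n (f : V -> 'M[R]_(m, n)) x v (df : 'M[R]_(m, n)) :
  (forall i j, is_derive x v (fun y => f y i j : R) (df i j)) ->
  is_derive x v f df.
Proof.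
move=> H.
have D : derivable f x v by apply/derivable_mxP => i j; case: (H i j).
split=> //; rewrite derive_mx //; apply/matrixP => i j; rewrite mxE.
by case: (H i j).
Qed.

Lemma is_derive_entry m n (f : V -> 'M[R]_(m, n)) x v (df : 'M[R]_(m, n)) i j :
  is_derive x v f df -> is_derive x v (fun y => f y i j : R) (df i j).
Proof.
case=> D E; split; first by move/derivable_mxP: D; apply.
by rewrite -E derive_mx // mxE.
Qed.

Lemma is_derive_prod (f g : V -> R) x v (df dg : R) :
  is_derive x v f df -> is_derive x v g dg ->
  is_derive x v (fun y => f y * g y) (df * g x + f x * dg).
Proof.
move=> Df Dg; apply: is_derive_eq (is_deriveM Df Dg) _.
by rewrite addrC mulrC; congr (_ + _); rewrite mulrC.
Qed.

Lemma is_derive_prodr (f : V -> R) (c : R) x v (df : R) :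
  is_derive x v f df -> is_derive x v (fun y => f y * c) (df * c).
Proof.
move=> Df; have Dc : is_derive x v (fun=> c) (0 : R) by exact: is_derive_cst.
by apply: is_derive_eq (is_derive_prod Df Dc) _; rewrite mulr0 addr0.
Qed.

Lemma is_derive_finsum (W : normedModType R) n (h : 'I_n -> V -> W) x v
    (dh : 'I_n -> W) :
  (forall i, is_derive x v (h i) (dh i)) ->
  is_derive x v (fun y => \sum_(i < n) h i y) (\sum_(i < n) dh i).
Proof.
move=> /is_derive_sum; rewrite (_ : \sum_(i < n) h i = fun y => \sum_(i < n) h i y) //.
by apply/funext => y; rewrite fct_sumE.
Qed.

Lemma is_derive_sp n (f g : V -> 'rV[R]_n) x v (df dg : 'rV[R]_n) :
  is_derive x v f df -> is_derive x v g dg ->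
  is_derive x v (fun y => scalar_prod (f y) (g y))
    (scalar_prod df (g x) + scalar_prod (f x) dg).
Proof.
move=> Df Dg; rewrite /scalar_prod -big_split; apply: is_derive_finsum => i.
by apply: is_derive_prod; apply: is_derive_entry.
Qed.

Lemma is_derive_cprod (f g : V -> 'rV[R]_7) x v (df dg : 'rV[R]_7) :
  is_derive x v f df -> is_derive x v g dg ->
  is_derive x v (fun y => cprod (f y) (g y)) (cprod df (g x) + cprod (f x) dg).
Proof.
move=> Df Dg; apply: is_derive_mx => l k; rewrite ord1 mxE !cprodE.
under eq_fun do rewrite cprodE.
rewrite -big_split; apply: is_derive_finsum => i.
rewrite -big_split; apply: is_derive_finsum => j /=.
rewrite -mulrDl; apply: is_derive_prodr.
by apply: is_derive_prod; apply: is_derive_entry.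
Qed.

Lemma is_derive_mulmxr m n k (f : V -> 'M[R]_(m, n)) (A : 'M[R]_(n, k)) x v
    (df : 'M[R]_(m, n)) :
  is_derive x v f df -> is_derive x v (fun y => f y *m A) (df *m A).
Proof.
move=> Df; apply: is_derive_mx => i j; rewrite mxE.
under eq_fun do rewrite mxE.
apply: is_derive_finsum => l; apply: is_derive_prodr.
exact: is_derive_entry Df.
Qed.

Lemma is_derive_tr m n (f : V -> 'M[R]_(m, n)) x v (df : 'M[R]_(m, n)) :
  is_derive x v f df -> is_derive x v (fun y => (f y)^T) df^T.
Proof.
move=> Df; apply: is_derive_mx => i j; rewrite mxE.
under eq_fun do rewrite mxE.
exact: is_derive_entry.
Qed.

Lemma is_derive_unique (W : normedModType R) (f : V -> W) x v (a b : W) :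
  is_derive x v f a -> is_derive x v f b -> a = b.
Proof. by case=> _ <- [_ <-]. Qed.

End Derivatives.

(** * The matrix exponential at the origin *)

Section Exponential.
Context {R : realType}.

Lemma cvg_mx (m n : nat) (u : nat -> 'M[R]_(m, n)) (l : 'M[R]_(m, n)) :
  (forall i j, (fun k => u k i j : R) @ \oo --> (l i j : R)) -> u @ \oo --> l.
Proof.
move=> ul; apply/cvgrPdist_le => /= e e0; near=> k.
rewrite /Num.Def.normr/= mx_normrE (bigmax_le _ (ltW e0))//= => i _.
rewrite !mxE/=.
move: i; near: k; apply: filter_forall => /= i.
exact: ((cvgrPdist_le _ _).1 (ul i.1 i.2)).
Unshelve. all: by end_near. Qed.

Variable A : 'M[R]_7.

(** The Taylor coefficients at the origin of the [m]-th derivative of an entry of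
    [t |-> exp (t A)]. *)
Definition exp_entry (m : nat) (i j : 'I_7) (n : nat) : R :=
  (n`!%:R)^-1 * (A ^+ (n + m)) i j.

(** The entries of [A ^ n] are at most [B ^ n], where [B] is the sum of the absolute
    values of the entries of [A]; this bounds the series by an exponential series. *)
Lemma exp_entry_cvg m i j (x : R) : cvgn (pseries (exp_entry m i j) x).
Proof.
pose B : R := \sum_k \sum_l `|A k l|.
have B0 : 0 <= B by apply: sumr_ge0 => k _; apply: sumr_ge0.
have AB n k l : `|(A ^+ n) k l| <= B ^+ n.
  elim: n k l => [|n IH] k l.
    by rewrite !expr0 mxE; case: (k == l) => /=; rewrite ?normr1 ?normr0.
  rewrite exprSr [X in _ <= X]exprSr [X in `|X|]mxE.
  apply: le_trans (ler_norm_sum _ _ _) _.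
  apply: (@le_trans _ _ (\sum_k0 B ^+ n * `|A k0 l|)).
    by apply: ler_sum => q _; rewrite normrM ler_wpM2r.
  rewrite -mulr_sumr ler_wpM2l ?exprn_ge0 //.
  apply: ler_sum => q _; rewrite (bigD1 l) //= lerDl; exact: sumr_ge0.
apply: normed_cvg; apply: (@series_le_cvg _ _ (B ^+ m *: exp_coeff (B * `|x|))).
- by move=> n; rewrite normr_ge0.
- by move=> n; rewrite mulr_ge0 ?exprn_ge0 // divr_ge0 // exprn_ge0 // mulr_ge0.
- move=> n; rewrite /= /exp_entry /exp_coeff /= !normrM normrX.
  rewrite ger0_norm ?invr_ge0 //.
  have -> : (B ^+ m *: (fun n0 : nat => (B * `|x|) ^+ n0 / n0`!%:R)) n
      = (n`!%:R)^-1 * B ^+ (n + m) * `|x| ^+ n.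
    transitivity (B ^+ m * ((B * `|x|) ^+ n / n`!%:R)) => //.
    by rewrite exprD exprMn; ring.
  by rewrite ler_wpM2r ?exprn_ge0 // ler_wpM2l ?invr_ge0.
- exact: is_cvg_seriesZ (is_cvg_series_exp_coeff _).
Qed.

Lemma pseries_diffs_exp_entry m i j :
  pseries_diffs (exp_entry m i j) = exp_entry m.+1 i j.
Proof.
apply/funext => n; rewrite /pseries_diffs /exp_entry factS natrM invfM.
by rewrite addSnnS mulrA mulVKf // pnatr_eq0.
Qed.

Lemma lim_pseries0 (c : nat -> R) : limn (pseries c 0) = c 0%N.
Proof.
apply: cvg_lim => //; apply: cvg_near_cst; exists 1%N => // -[//|n] _.
rewrite /pseries /series /= big_nat_recl // expr0 mulr1 big1 ?addr0 // => k _.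
by rewrite exprS mul0r mulr0.
Qed.

Lemma expmx_entry (t : R) i j :
  expmx (t *: A) i j = limn (pseries (exp_entry 0 i j) t).
Proof.
pose L : 'M[R]_7 := \matrix_(i, j) limn (pseries (exp_entry 0 i j) t).
rewrite (_ : expmx _ = L) ?mxE //; apply: cvg_lim => //; apply: cvg_mx => k l.
rewrite [X in _ --> X]mxE.
rewrite (_ : (fun _ => _) = pseries (exp_entry 0 k l) t); first exact: exp_entry_cvg.
apply/funext => N; rewrite /series /pseries /= summxE; apply: eq_bigr => n _.
by rewrite exprZn mxE mxE /exp_entry addn0; ring.
Qed.

Lemma expmx0 : expmx ((0 : R) *: A) = 1.
Proof.
apply/matrixP => i j; rewrite expmx_entry lim_pseries0 /exp_entry.
by rewrite fact0 invr1 mul1r expr0.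
Qed.

Lemma is_derive_expmx : is_derive (0 : R) 1 (fun t : R => expmx (t *: A)) A.
Proof.
apply: is_derive_mx => i j; under eq_fun do rewrite expmx_entry.
apply: is_derive_eq.
  apply: (@pseries_snd_diffs _ _ 1).
  - exact: exp_entry_cvg.
  - by rewrite pseries_diffs_exp_entry; exact: exp_entry_cvg.
  - by rewrite !pseries_diffs_exp_entry; exact: exp_entry_cvg.
  - by rewrite normr0 normr1.
by rewrite pseries_diffs_exp_entry lim_pseries0 /exp_entry fact0 invr1 mul1r expr1.
Qed.

Lemma is_derive_exp_action (p : 'rV[R]_7) :
  is_derive (0 : R) 1 (fun t : R => p *m (expmx (t *: A))^T) (p *m A^T).
Proof.
have := is_derive_tr (is_derive_mulmxr p^T is_derive_expmx).
rewrite trmx_mul trmxK.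
by under eq_fun do rewrite trmx_mul trmxK.
Qed.

Lemma fundamentalE p : fundamental A p = p *m A^T.
Proof. by rewrite /fundamental derive1E; case: (is_derive_exp_action p). Qed.

End Exponential.

Section Derivations.
Context {R : realType}.

(** The infinitesimal form of [G2_preserves], for the linear map [u |-> u *m D]. *)
Definition derivation (D : 'M[R]_7) : Prop :=
  (forall u v, scalar_prod (u *m D) v = - scalar_prod u (v *m D)) /\
  (forall u v, cprod u v *m D = cprod (u *m D) v + cprod u (v *m D)).

(** Only the derivative of [t |-> exp (t xi)] at the origin is used: the two
    identities of [G2_preserves] are differentiated there. *)
Lemma g2_derivation (xi : 'M[R]_7) : g2 R xi -> derivation xi^T.
Proof.
move=> xiG; have E0 (u : 'rV[R]_7) : u *m (expmx ((0 : R) *: xi))^T = u.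
  by rewrite expmx0 trmx1 mulmx1.
split=> u v; have Du := is_derive_exp_action xi u;
  have Dv := is_derive_exp_action xi v.
- have := is_derive_sp Du Dv; rewrite !E0.
  under eq_fun do rewrite (G2_preserves (xiG _) _ _).1.
  move/is_derive_unique/(_ (is_derive_cst (scalar_prod u v : R) (0 : R) (1 : R))).
  by move/eqP; rewrite addr_eq0 => /eqP.
- have := is_derive_cprod Du Dv; rewrite !E0.
  under eq_fun do rewrite (G2_preserves (xiG _) _ _).2.
  by move/(is_derive_unique (is_derive_exp_action _ _)).
Qed.

End Derivations.

(** * Smooth maps *)

Section SmoothMaps.
Context {R : realType} {V : normedModType R}.

Lemma is_derive_linear (W W' : normedModType R) (L : {linear W -> W'})
    (f : V -> W) (x v : V) (df : W) :
  continuous L -> is_derive x v f df -> is_derive x v (fun y => L (f y)) (L df).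
Proof.
move=> cL [/cvg_ex[l fl] E].
have El : l = df by rewrite -E; apply/esym/cvg_lim.
have LG : (fun h : R => h^-1 *: (((L \o f) \o shift x) (h *: v) - (L \o f) x))
    @ 0^' --> L df.
  rewrite (_ : (fun h => _) =
    L \o (fun h : R => h^-1 *: ((f \o shift x) (h *: v) - f x))).
    by apply: continuous_cvg; [exact: cL|rewrite -El].
  by apply/funext => h /=; rewrite -linearB -linearZ_LR.
split; first by apply/cvg_ex; exists (L df).
exact: cvg_lim.
Qed.

Lemma Ck_continuous k (W : normedModType R) (f : V -> W) : Ck k f -> continuous f.
Proof. by case: k => [|k] []. Qed.

Lemma CkS k (W : normedModType R) (f : V -> W) : Ck k.+1 f -> Ck k f.
Proof.
elim: k f => [|k IH] f; first by case.
by case=> cf Df; split=> // v; case: (Df v) => dfv Cv; split=> //; exact: IH.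
Qed.

Lemma CkSP k (W : normedModType R) (f : V -> W) (df : V -> V -> W) :
  continuous f -> (forall v x, is_derive x v f (df v x)) ->
  (forall v, Ck k (df v)) -> Ck k.+1 f.
Proof.
move=> cf D C; split=> // v; split=> [x|]; first by case: (D v x).
have -> : (fun x => 'D_v f x) = df v by apply/funext => x; case: (D v x).
exact: C.
Qed.

Lemma Ck_derive k (W : normedModType R) (f : V -> W) (v x : V) :
  Ck k.+1 f -> is_derive x v f ('D_v f x).
Proof. by case=> _ /(_ v)[D _]; split. Qed.

Lemma Ck_cst k (W : normedModType R) (w : W) : Ck k (fun _ : V => w).
Proof.
elim: k w => [|k IH] w; first by split=> //; exact: cst_continuous.
apply: (@CkSP _ _ _ (fun _ _ => 0)) => [x|v]; last exact: IH.
exact: cvg_cst.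
Qed.

Lemma CkD k (W : normedModType R) (f g : V -> W) :
  Ck k f -> Ck k g -> Ck k (fun x => f x + g x).
Proof.
elim: k f g => [|k IH] f g Cf Cg; have cf := Ck_continuous Cf;
  have cg := Ck_continuous Cg.
  by split=> // x; apply: cvgD; [exact: cf|exact: cg].
apply: (@CkSP _ _ _ (fun v x => 'D_v f x + 'D_v g x)).
- by move=> x; apply: cvgD; [exact: cf|exact: cg].
- by move=> v x; exact: is_deriveD (Ck_derive v x Cf) (Ck_derive v x Cg).
- by move=> v; apply: IH; [case: Cf|case: Cg] => _ /(_ v)[].
Qed.

Lemma CkM k (f g : V -> R) : Ck k f -> Ck k g -> Ck k (fun x => f x * g x : R).
Proof.
elim: k f g => [|k IH] f g Cf Cg; have cf := Ck_continuous Cf;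
  have cg := Ck_continuous Cg.
  by split=> // x; apply: cvgM; [exact: cf|exact: cg].
apply: (@CkSP _ _ _ (fun v x => 'D_v f x * g x + f x * 'D_v g x)).
- by move=> x; apply: cvgM; [exact: cf|exact: cg].
- by move=> v x; exact: is_derive_prod (Ck_derive v x Cf) (Ck_derive v x Cg).
- move=> v; apply: CkD; apply: IH; try exact: CkS.
  + by case: Cf => _ /(_ v)[].
  + by case: Cg => _ /(_ v)[].
Qed.

Lemma Ck_linear k (W W' : normedModType R) (L : {linear W -> W'}) (f : V -> W) :
  continuous L -> Ck k f -> Ck k (fun x => L (f x)).
Proof.
move=> cL; elim: k f => [|k IH] f Cf; have cf := Ck_continuous Cf.
  by split=> // x; apply: continuous_comp; [exact: cf|exact: cL].
apply: (@CkSP _ _ _ (fun v x => L ('D_v f x))).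
- by move=> x; apply: continuous_comp; [exact: cf|exact: cL].
- by move=> v x; exact: is_derive_linear cL (Ck_derive v x Cf).
- by move=> v; apply: IH; case: Cf => _ /(_ v)[].
Qed.

Lemma Ck_id k : Ck k (fun x : V => x).
Proof.
case: k => [|k]; first by split=> // x; exact: cvg_id.
apply: (@CkSP _ _ _ (fun v x => v)) => [x|v]; first exact: cvg_id.
exact: Ck_cst.
Qed.

Lemma linear_bundle (U W : lmodType R) (f : U -> W) : linear f ->
  exists L : {linear U -> W}, L = f :> (U -> W).
Proof.
move=> lf; pose M := GRing.isLinear.Build _ _ _ _ _ lf.
by pose L : {linear U -> W} := HB.pack f M; exists L.
Qed.

Lemma is_derive_scalel (W : normedModType R) (f : V -> R) (w : W) x v (df : R) :
  is_derive x v f df -> is_derive x v (fun y => f y *: w) (df *: w).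
Proof.
have [|L EL] := @linear_bundle R^o W (fun r => r *: w).
  by move=> a y z; rewrite scalerDl scalerA.
move=> Df; have -> : (fun x => f x *: w) = (fun x => L (f x)) by rewrite EL.
have -> : df *: w = L df by rewrite EL.
by apply: is_derive_linear => //; rewrite EL; exact: scalel_continuous.
Qed.

Lemma CkZl k (W : normedModType R) (f : V -> R) (w : W) :
  Ck k f -> Ck k (fun x => f x *: w).
Proof.
have [|L EL] := @linear_bundle R^o W (fun r => r *: w).
  by move=> a x y; rewrite scalerDl scalerA.
move=> Cf; have -> : (fun x => f x *: w) = (fun x => L (f x)) by rewrite EL.
by apply: Ck_linear => //; rewrite EL; exact: scalel_continuous.
Qed.

Lemma Ck_coord k m n (f : V -> 'M[R]_(m, n)) i j :
  Ck k f -> Ck k (fun x => f x i j : R).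
Proof.
have cc (g : V -> 'M[R]_(m, n)) : continuous g -> continuous (fun x => g x i j : R).
  move=> cg x.
  apply: (@continuous_comp _ _ _ g (fun M : 'M[R]_(m, n) => M i j)); first exact: cg.
  exact: coord_continuous.
elim: k f => [|k IH] f Cf; have cf := cc _ (Ck_continuous Cf).
  by split.
apply: (@CkSP _ _ _ (fun v x => 'D_v f x i j)).
- exact: cf.
- by move=> v x; exact: is_derive_entry i j (Ck_derive v x Cf).
- by move=> v; apply: IH; case: Cf => _ /(_ v)[].
Qed.

Lemma Ck_sum k (W : normedModType R) (I : Type) (r : seq I) (f : I -> V -> W) :
  (forall i, Ck k (f i)) -> Ck k (fun x => \sum_(i <- r) f i x).
Proof.
move=> Cf; elim: r => [|i r IH].
  by under eq_fun do rewrite big_nil; exact: Ck_cst.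
by under eq_fun do rewrite big_cons; exact: CkD.
Qed.

Lemma differentiable_sum_seq (W : normedModType R) (I : Type) (r : seq I)
    (f : I -> V -> W) x :
  (forall i, differentiable (f i) x) ->
  differentiable (fun y => \sum_(i <- r) f i y) x.
Proof.
move=> Df; elim: r => [|i r IH].
  by under eq_fun do rewrite big_nil; exact: differentiable_cst.
by under eq_fun do rewrite big_cons; exact: differentiableD.
Qed.

Lemma is_derive_differentiable (W : normedModType R) (f : V -> W) x v w :
  differentiable f x -> is_derive x v f w -> 'd f x v = w.
Proof. by move=> Df [_ <-]; rewrite deriveE. Qed.

(** Circular motion at an angle depending linearly on the point; this family of
    maps is stable under differentiation. *)
Definition circular (W : normedModType R) (l : V -> R) (A B : W) (x : V) : W :=
  cos (l x) *: A + sin (l x) *: B.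

Section Circular.
Variables (W : normedModType R) (l : V -> R).
Hypotheses (l_lin : linear (l : V -> R^o)) (l_cont : continuous l).

Lemma diff_comp_linear_form (f : R -> R) (x v : V) (df : R) :
  is_derive (l x) (1 : R) f df ->
  differentiable (fun y => f (l y)) x /\ is_derive x v (fun y => f (l y)) (df * l v).
Proof.
move=> Df; have [L EL] := @linear_bundle V (R^o : normedModType R) l l_lin.
have cL : continuous L by rewrite EL; exact: l_cont.
have Dl : differentiable l x by have := linear_differentiable x cL; rewrite EL.
have Dfx : differentiable f (l x) by apply/derivable1_diffP; case: Df.
have D : differentiable (f \o l) x by exact: differentiable_comp.
split=> //; split; first exact: diff_derivable.
rewrite deriveE // diff_comp //=.
have -> : 'd l x v = l v by rewrite -[X in 'd X x]EL (diff_lin _ cL) EL.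
by rewrite diff1E // derive1E; case: Df => _ ->; rewrite mulrC.
Qed.

Lemma differentiable_circular (A B : W) x : differentiable (circular l A B) x.
Proof.
apply: differentiableD; apply: differentiableZl.
  by have [] := diff_comp_linear_form 0 (is_derive_cos (l x)).
by have [] := diff_comp_linear_form 0 (is_derive_sin (l x)).
Qed.

Lemma is_derive_circular (A B : W) x v :
  is_derive x v (circular l A B) (circular l (l v *: B) (- (l v *: A)) x).
Proof.
have [_ Dc] := diff_comp_linear_form v (is_derive_cos (l x)).
have [_ Ds] := diff_comp_linear_form v (is_derive_sin (l x)).
apply: is_derive_eq (is_deriveD (is_derive_scalel A Dc) (is_derive_scalel B Ds)) _.
by rewrite /circular scalerN !scalerA addrC mulNr scaleNr.
Qed.

Lemma Ck_circular k (A B : W) : Ck k (circular l A B).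
Proof.
have cc (A' B' : W) : continuous (circular l A' B').
  by move=> x; apply: differentiable_continuous; exact: differentiable_circular.
elim: k A B => [|k IH] A B; first by split.
apply: (@CkSP _ _ _ (fun v => circular l (l v *: B) (- (l v *: A)))) => //.
by move=> v x; exact: is_derive_circular.
Qed.

End Circular.

End SmoothMaps.

(** * Stereographic charts *)

Section Charts.
Context {R : realType}.

Section Differentiable.
Context {V : normedModType R}.

Lemma differentiable_rV n (f : V -> 'rV[R]_n) x :
  (forall j, differentiable (fun y => f y 0 j : R) x) -> differentiable f x.
Proof.
move=> Df; have -> : f = fun y => \sum_j f y 0 j *: delta_mx 0 j.
  by apply/funext => y; rewrite -row_sum_delta.
by apply: differentiable_sum_seq => j; exact: differentiableZl.
Qed.

Lemma is_derive_inv (f : V -> R) x v (df : R) : f x != 0 ->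
  is_derive x v f df -> is_derive x v (fun y => (f y)^-1) (- (f x) ^- 2 * df).
Proof.
move=> fx0 [Df E]; split; first exact: derivableV.
by rewrite deriveV // E.
Qed.

Lemma is_derive_scale n (f : V -> R) (g : V -> 'rV[R]_n) x v (df : R)
    (dg : 'rV[R]_n) :
  is_derive x v f df -> is_derive x v g dg ->
  is_derive x v (fun y => f y *: g y) (df *: g x + f x *: dg).
Proof.
move=> Df Dg; apply: is_derive_mx => i j; rewrite !mxE.
under eq_fun do rewrite mxE.
by apply: is_derive_prod => //; exact: is_derive_entry.
Qed.

End Differentiable.

Lemma mul_jacobian m n (f : 'rV[R]_m -> 'rV[R]_n) x v w :
  differentiable f x -> is_derive x v f w -> v *m 'J f x = w.
Proof. by move=> Df [_ <-]; rewrite deriveEjacobian. Qed.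

Definition horiz (p : 'rV[R]_7) : 'rV[R]_6 := lsubmx (p : 'rV[R]_(6 + 1)).
Definition height (p : 'rV[R]_7) : R := p 0 ord_max.
Definition lift7 (x : 'rV[R]_6) (z : R) : 'rV[R]_7 :=
  (row_mx x (const_mx z) : 'rV[R]_(6 + 1)).

Lemma ord_max_rshift : (ord_max : 'I_7) = rshift 6 (0 : 'I_1).
Proof. exact: val_inj. Qed.

Lemma horizE p i : horiz p 0 i = p 0 (lshift 1 i).
Proof. by rewrite mxE. Qed.

Lemma lift7K p : lift7 (horiz p) (height p) = p.
Proof.
rewrite -[RHS](@hsubmxK _ 1 6 1 (p : 'rV[R]_(6 + 1))).
congr (row_mx (n1 := 6) (n2 := 1)).
by apply/rowP => i; rewrite !mxE !ord1 /height ord_max_rshift.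
Qed.

Lemma horiz_lift7 x z : horiz (lift7 x z) = x.
Proof. exact: row_mxKl. Qed.

Lemma height_lift7 x z : height (lift7 x z) = z.
Proof.
rewrite /height ord_max_rshift.
exact: etrans (row_mxEr x (const_mx z : 'rV[R]_1) 0 0) (mxE _ _ _ _).
Qed.

Lemma lift7P p q : horiz p = horiz q -> height p = height q -> p = q.
Proof. by move=> hp zp; rewrite -(lift7K p) -(lift7K q) hp zp. Qed.

Lemma sp_horiz u v : scalar_prod u v = scalar_prod (horiz u) (horiz v) + height u * height v.
Proof.
rewrite /scalar_prod big_ord_recr; congr (_ + _ * _) => //.
by apply: eq_bigr => i _; rewrite !horizE; congr (u _ _ * v _ _); apply: val_inj.
Qed.

Lemma horizD u v : horiz (u + v) = horiz u + horiz v.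
Proof. by apply/rowP => i; rewrite !mxE. Qed.

Lemma horizZ (a : R) u : horiz (a *: u) = a *: horiz u.
Proof. by apply/rowP => i; rewrite !mxE. Qed.

Lemma heightD u v : height (u + v) = height u + height v.
Proof. by rewrite /height mxE. Qed.

Lemma heightZ (a : R) u : height (a *: u) = a * height u.
Proof. by rewrite /height mxE. Qed.

Implicit Types (x h : 'rV[R]_6) (p v : 'rV[R]_7).

Variable b : bool.
Let s : R := (-1) ^+ b.
Let ss : s * s = 1. Proof. by rewrite -expr2 sqrr_sign. Qed.

Let q (x : 'rV[R]_6) : R := scalar_prod x x + 1.
Let q0 x : q x != 0. Proof. by rewrite gt_eqF // ltr_wpDl ?sp_ge0. Qed.

Lemma stereoE p : stereo b p = (1 - s * height p)^-1 *: horiz p.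
Proof. by []. Qed.

Lemma stereo_invE x :
  stereo_inv b x = (q x)^-1 *: lift7 (2 *: x) (s * (q x - 2)).
Proof.
apply: lift7P.
  by rewrite horizZ !horiz_lift7 scalerA mulrC.
by rewrite heightZ !height_lift7 -/s /q; field; exact: q0.
Qed.

Definition dstereo p v : 'rV[R]_6 :=
  (1 - s * height p)^-1 *: horiz v
  + (s * height v * (1 - s * height p) ^- 2) *: horiz p.

Definition dstereo_inv x h : 'rV[R]_7 :=
  (2 * (q x)^-1) *: lift7 h 0
  + (4 * scalar_prod x h * (q x) ^- 2) *: lift7 (- x) s.

Lemma horiz_stereo_inv x : horiz (stereo_inv b x) = (2 / q x) *: x.
Proof. by rewrite stereo_invE horizZ horiz_lift7 scalerA mulrC. Qed.

Lemma height_stereo_inv x : height (stereo_inv b x) = s * (1 - 2 / q x).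
Proof. rewrite stereo_invE heightZ height_lift7; field; exact: q0. Qed.

Lemma sphere_stereo_inv x : sphere R (stereo_inv b x).
Proof.
rewrite /sphere /= sp_horiz horiz_stereo_inv height_stereo_inv.
rewrite mulrACA ss mul1r spZl spZr.
have -> : scalar_prod x x = q x - 1 by rewrite /q addrK.
by field; exact: q0.
Qed.

Lemma chart_denom_inv x : 1 - s * height (stereo_inv b x) = 2 / q x.
Proof. by rewrite height_stereo_inv mulrA ss mul1r; ring. Qed.

Lemma stereo_invK x : stereo b (stereo_inv b x) = x.
Proof.
rewrite stereoE chart_denom_inv horiz_stereo_inv scalerA invfM invrK.
rewrite (_ : _ * _ = 1) ?scale1r //; field; exact: q0.
Qed.

Section AtPoint.
Variable p : 'rV[R]_7.
Hypotheses (pp : sphere R p) (p0 : 1 - s * height p != 0).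

Let d : R := 1 - s * height p.

Let heightE : height p = s * (1 - d).
Proof. by rewrite /d subKr mulrA ss mul1r. Qed.

Let sp_horizE : scalar_prod (horiz p) (horiz p) = d * (2 - d).
Proof.
move: pp; rewrite /sphere /= sp_horiz => /(canRL (addrK _)) ->.
by rewrite heightE mulrACA ss; ring.
Qed.

Lemma q_stereo : q (stereo b p) = 2 / d.
Proof.
rewrite /q stereoE -/d spZl spZr sp_horizE; field; exact: p0.
Qed.

Lemma stereoK : stereo_inv b (stereo b p) = p.
Proof.
apply: lift7P.
  rewrite horiz_stereo_inv q_stereo stereoE -/d scalerA.
  rewrite (_ : _ * _ = 1) ?scale1r //; field; exact: p0.
rewrite height_stereo_inv q_stereo heightE; field; exact: p0.
Qed.

(** A tangent vector is recovered from its image under the differential of the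
    chart, since the chart is inverse to the parametrisation on the sphere. *)
Lemma dstereoK v : scalar_prod v p = 0 -> dstereo_inv (stereo b p) (dstereo p v) = v.
Proof.
rewrite sp_horiz => /eqP; rewrite addr_eq0 => /eqP vp.
have xh : scalar_prod (stereo b p) (dstereo p v) = s * height v / d ^+ 2.
  rewrite stereoE /dstereo -/d spDr !spZl !spZr sp_horizE spC vp heightE.
  field; exact: p0.
rewrite /dstereo_inv xh q_stereo; apply: lift7P.
  rewrite horizD !horizZ !horiz_lift7 /dstereo stereoE -/d scalerDr scalerN.
  rewrite !scalerA -addrA -scalerBl.
  rewrite (_ : _ * _ = 1); last by field; exact: p0.
  rewrite scale1r (_ : _ - _ = 0) ?scale0r ?addr0 //; field; exact: p0.
rewrite heightD !heightZ !height_lift7 mulr0 add0r.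
transitivity (s * s * height v); last by rewrite ss mul1r.
field; exact: p0.
Qed.

End AtPoint.

Lemma differentiable_q x : differentiable q x.
Proof.
apply: differentiableD; last exact: differentiable_cst.
apply: (@differentiable_sum_seq _ _ R^o) => i.
by apply: differentiableM; exact: differentiable_coord.
Qed.

Lemma is_derive_q x h : is_derive x h q (2 * scalar_prod x h).
Proof.
have D := is_derive_id x h; have D1 : is_derive x h (fun=> 1 : R) (0 : R) by exact: is_derive_cst.
apply: is_derive_eq (is_deriveD (is_derive_sp D D) D1) _.
by rewrite addr0 (spC h) -mulr2n mulr_natl.
Qed.

Lemma lift7El x z i : lift7 x z 0 (lshift 1 i : 'I_(6 + 1)) = x 0 i.
Proof. exact: row_mxEl. Qed.

Lemma lift7Er x z (i : 'I_1) : lift7 x z 0 (rshift 6 i : 'I_(6 + 1)) = z.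
Proof. exact: etrans (row_mxEr x (const_mx z : 'rV[R]_1) 0 i) (mxE _ _ _ _). Qed.

Lemma is_derive_lift7 (V : normedModType R) (f : V -> 'rV[R]_6) (g : V -> R)
    (y w : V) (df : 'rV[R]_6) (dg : R) :
  is_derive y w f df -> is_derive y w g dg ->
  is_derive y w (fun y => lift7 (f y) (g y)) (lift7 df dg).
Proof.
move=> Df Dg; apply: is_derive_mx => i k; rewrite ord1.
have [{}k ->|{}k ->] := @split_ordP 6 1 k.
  by rewrite lift7El; under eq_fun do rewrite lift7El; exact: is_derive_entry.
by rewrite lift7Er; under eq_fun do rewrite lift7Er.
Qed.

Lemma differentiable_lift7 (V : normedModType R) (f : V -> 'rV[R]_6) (g : V -> R)
    (y : V) :
  (forall i, differentiable (fun y => f y 0 i : R) y) -> differentiable g y ->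
  differentiable (fun y => lift7 (f y) (g y)) y.
Proof.
move=> Df Dg; apply: differentiable_rV => k.
have [{}k ->|{}k ->] := @split_ordP 6 1 k.
  by under eq_fun do rewrite lift7El.
by under eq_fun do rewrite lift7Er.
Qed.

Let stereo_inv_fun :
  stereo_inv b = fun x => lift7 (((q x)^-1 * 2) *: x) ((1 - (q x)^-1 * 2) * s).
Proof.
apply/funext => x; apply: lift7P.
  by rewrite horiz_stereo_inv horiz_lift7 mulrC.
by rewrite height_stereo_inv height_lift7 mulrC (mulrC 2).
Qed.

Lemma differentiable_stereo_inv x : differentiable (stereo_inv b) x.
Proof.
have Dq : differentiable (fun x => (q x)^-1 * 2 : R) x.
  apply: differentiableM; last exact: differentiable_cst.
  by apply: differentiableV; [exact: differentiable_q|exact: q0].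
rewrite stereo_inv_fun; apply: differentiable_lift7 => [i|].
  under eq_fun do rewrite mxE.
  by apply: differentiableM => //; exact: differentiable_coord.
apply: differentiableM; last exact: differentiable_cst.
by apply: differentiableB => //; exact: differentiable_cst.
Qed.

Lemma is_derive_stereo_inv x h : is_derive x h (stereo_inv b) (dstereo_inv x h).
Proof.
have D1 : is_derive x h (fun=> 1 : R) (0 : R) by exact: is_derive_cst.
have Dq := is_derive_prodr 2 (is_derive_inv (q0 x) (is_derive_q x h)).
have Dz := is_derive_prodr s (is_deriveB D1 Dq).
rewrite stereo_inv_fun.
apply: is_derive_eq (is_derive_lift7 (is_derive_scale Dq (is_derive_id x h)) Dz) _.
rewrite /dstereo_inv; apply: lift7P.
  rewrite horizD !horizZ !horiz_lift7 addrC scalerN -scaleNr mulrC.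
  by congr (_ + _ *: _); ring.
by rewrite heightD !heightZ !height_lift7 mulr0 add0r; ring.
Qed.

Lemma differentiable_stereo p : 1 - s * height p != 0 -> differentiable (stereo b) p.
Proof.
move=> p0; apply: differentiable_rV => i.
have -> : (fun p => stereo b p 0 i : R)
    = fun p => (1 - s * p 0 ord_max)^-1 * p 0 (lshift 1 i).
  by apply/funext => y; rewrite stereoE mxE horizE.
apply: differentiableM; last exact: differentiable_coord.
apply: differentiableV => //; apply: differentiableB; first exact: differentiable_cst.
apply: differentiableM; first exact: differentiable_cst.
exact: differentiable_coord.
Qed.

Lemma is_derive_stereo p v : 1 - s * height p != 0 ->
  is_derive p v (stereo b) (dstereo p v).
Proof.
move=> p0; have D1 : is_derive p v (fun=> 1 : R) (0 : R) by exact: is_derive_cst.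
have Did := is_derive_id p v.
have Dd : is_derive p v (fun y => 1 - s * height y) (- (s * height v)).
  under eq_fun do rewrite mulrC.
  apply: is_derive_eq (is_deriveB D1 (is_derive_prodr s (is_derive_entry 0 ord_max Did))) _.
  by rewrite sub0r mulrC.
have Dy : is_derive p v horiz (horiz v).
  apply: is_derive_mx => j i; rewrite ord1 horizE; under eq_fun do rewrite horizE.
  exact: is_derive_entry Did.
have D := is_derive_scale (is_derive_inv (f := fun y => 1 - s * height y) p0 Dd) Dy.
rewrite (_ : stereo b = fun y => (1 - s * height y)^-1 *: horiz y) //.
apply: is_derive_eq D _.
by rewrite /dstereo addrC; congr (_ + _ *: _); ring.
Qed.

End Charts.

(** * The potential, and the Hamilton-de Donder-Weyl equation *)

Section Potential.
Context {R : realType}.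
Implicit Types (p u v : 'rV[R]_7).

Lemma pair_rows n (M : 'M[R]_(2, n)) : M = col_mx (row 0 M) (row 1 M) :> 'M[R]_(2, n).
Proof. by apply/row_matrixP; apply: ord2_ind; rewrite ?row0_pair ?row1_pair. Qed.

(** The chart used at [p] projects from the pole of the other hemisphere. *)
Lemma chart_at_defined p : 1 - (-1) ^+ (0 < p 0 ord_max)%R * height p != 0.
Proof.
rewrite /height; case: ltP => p0; rewrite ?expr1 ?expr0 ?mul1r ?mulN1r ?opprK gt_eqF //.
  by rewrite addr_gt0.
by rewrite subr_gt0 (le_lt_trans p0).
Qed.

Lemma jacobian_stereo k p (v : 'M[R]_(k, 7)) (b : bool) i : 1 - (-1) ^+ b * height p != 0 ->
  row i (v *m 'J (stereo b) p) = dstereo b p (row i v).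
Proof.
move=> p0; rewrite row_mul.
exact: mul_jacobian (differentiable_stereo p0) (is_derive_stereo _ p0).
Qed.

Lemma jacobian_stereo_inv b x h :
  h *m 'J (stereo_inv b) x = dstereo_inv b x h :> 'rV[R]_7.
Proof.
exact: mul_jacobian (differentiable_stereo_inv b x) (is_derive_stereo_inv b x h).
Qed.

Lemma tangent_dstereo_inv b (x h : 'rV[R]_6) :
  scalar_prod (dstereo_inv b x h) (stereo_inv b x) = 0.
Proof.
have D := is_derive_stereo_inv b x h.
have := is_derive_sp D D.
under eq_fun do rewrite [scalar_prod _ _]sphere_stereo_inv.
move/is_derive_unique/(_ (is_derive_cst (1 : R) x h)).
rewrite [X in _ + X]spC -mulr2n => /eqP; rewrite -mulr_natl mulf_eq0 pnatr_eq0.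
by move/eqP.
Qed.

Variable theta : dform R 2 7.
Hypotheses (theta_form : sphere_form theta)
  (theta_potential : sphere_form_eq (sphere_d theta) octonion_form)
  (theta_invariant : G2_invariant theta).

Lemma is_derive_dstereo_inv0 (b : bool) (h u : 'rV[R]_6) :
  is_derive (0 : 'rV[R]_6) h (fun y => dstereo_inv b y u)
    ((4 * scalar_prod h u) *: lift7 0 ((-1) ^+ b)).
Proof.
have Did := is_derive_id (0 : 'rV[R]_6) h.
have q0 : scalar_prod (0 : 'rV[R]_6) 0 + 1 != 0 :> R.
  by rewrite sp0l add0r oner_neq0.
have Dqi := is_derive_inv (f := fun y : 'rV[R]_6 => scalar_prod y y + 1) q0 (is_derive_q 0 h).
have Dsp : is_derive (0 : 'rV[R]_6) h (fun y => scalar_prod y u) (scalar_prod h u).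
  have Du : is_derive (0 : 'rV[R]_6) h (fun=> u) (0 : 'rV[R]_6) by exact: is_derive_cst.
  by apply: is_derive_eq (is_derive_sp Did Du) _; rewrite sp0r addr0.
have Ds : is_derive (0 : 'rV[R]_6) h (fun=> (-1) ^+ b : R) (0 : R) by exact: is_derive_cst.
have D2 := is_derive_scale (is_derive_prod (is_derive_prodr 4 Dsp) (is_derive_prod Dqi Dqi))
  (is_derive_lift7 (is_deriveN Did) Ds).
have D1 := is_derive_scalel (lift7 u 0) (is_derive_prodr 2 Dqi).
have D := is_deriveD D1 D2.
have -> : (fun y => dstereo_inv b y u)
    = (fun y => ((scalar_prod y y + 1)^-1 * 2) *: lift7 u 0)
    + (fun y => (scalar_prod y u * 4 * ((scalar_prod y y + 1)^-1
         * (scalar_prod y y + 1)^-1)) *: lift7 (- y) ((-1) ^+ b)).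
  apply/funext => y; rewrite /dstereo_inv.
  by congr (_ *: _ + _ *: _); rewrite ?(mulrC _ 2) // (mulrC _ 4) expr2 invfM.
apply: is_derive_eq D _.
rewrite !sp0l !(mulr0, mul0r, scale0r, add0r, addr0, invr1, mulr1) mulrC.
by rewrite [(- _) 0]oppr0.
Qed.

(** Evaluating [d theta = omega] at one point fixes the constant of
    [invariant_two_form]. At the south pole [-e_7], the second derivatives of the
    parametrisation are multiples of [e_7] and do not contribute. *)
Lemma potential_explicit p u v : sphere R p ->
  scalar_prod u p = 0 -> scalar_prod v p = 0 ->
  theta p (col_mx u v) = 3^-1 * scalar_prod (cprod p u) v.
Proof.
have [k thetaE] := invariant_two_form theta_form.1 theta_invariant.
suff -> : 3^-1 = k by exact: thetaE.
pose p0 : 'rV[R]_7 := lift7 0 (- 1).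
have sp0 : sphere R p0.
  by rewrite /sphere /= sp_horiz horiz_lift7 height_lift7 sp0l add0r mulrNN mulr1.
pose e (i : 'I_7) : 'rV[R]_7 := delta_mx 0 i.
pose m (i : 'I_3) : 'I_7 := widen_ord (isT : (3 <= 7)%N) i.
pose w : 'M[R]_(3, 7) := \matrix_(i < 3) e (m i).
have wE i : row i w = e (m i) by rewrite rowK.
have Tw : tangent p0 w.
  move=> i; rewrite wE sp_horiz horiz_lift7 sp0r height_lift7 add0r.
  rewrite /height mxE; move: i; apply: ord3_ind; by rewrite mul0r.
have := theta_potential sp0 Tw.
have p0h : height p0 = - 1 by exact: height_lift7.
have b0 : (0 < p0 0 ord_max) = false by rewrite [p0 0 _]p0h ltr0N1.
have nz : 1 - (-1) ^+ false * height p0 != 0.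
  by have := chart_at_defined p0; rewrite b0.
have x0 : stereo false p0 = 0 by rewrite stereoE [horiz _]horiz_lift7 scaler0.
have D (h u0 u1 : 'rV[R]_6) : is_derive (0 : 'rV[R]_6) h
    (fun y => theta (stereo_inv false y)
       (col_mx (dstereo_inv false y u0) (dstereo_inv false y u1)))
    (k * scalar_prod (cprod (dstereo_inv false 0 h) (dstereo_inv false 0 u0))
           (dstereo_inv false 0 u1)).
  have -> : (fun y => theta (stereo_inv false y)
       (col_mx (dstereo_inv false y u0) (dstereo_inv false y u1)))
    = fun y => scalar_prod (cprod (stereo_inv false y) (dstereo_inv false y u0))
         (dstereo_inv false y u1) * k.
    apply/funext => y; rewrite thetaE 1?mulrC //; first exact: sphere_stereo_inv.
      exact: tangent_dstereo_inv.
    exact: tangent_dstereo_inv.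
  rewrite mulrC; apply: is_derive_prodr.
  have D0 := is_derive_stereo_inv false 0 h.
  have Du z := is_derive_dstereo_inv0 false h z.
  apply: is_derive_eq (is_derive_sp (is_derive_cprod D0 (Du u0)) (Du u1)) _.
  have -> : stereo_inv false 0 = - lift7 0 1 :> 'rV[R]_7.
    apply: lift7P; rewrite -scaleN1r ?horizZ ?heightZ ?horiz_lift7 ?height_lift7.
      by rewrite !scaler0.
    by rewrite sp0l expr0 !add0r invr1; ring.
  rewrite cprodZr cprodNl cprodvv oppr0 scaler0 addr0 spZr.
  by rewrite cprodNl spNl sp_cprod_l oppr0 mulr0 addr0.
rewrite /sphere_d b0 {1}/pullback /ext_d x0; set W := w *m _.
have EW i : dstereo_inv false 0 (row i W) = e (m i).
  rewrite jacobian_stereo // -x0 dstereoK // -wE //; exact: Tw.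
have DW (i : 'I_3) : 'D_(row i W)
    (fun y => pullback (stereo_inv false) theta y (row' i W)) 0
    = k * scalar_prod (cprod (e (m i)) (e (m (lift i 0)))) (e (m (lift i 1))).
  rewrite -!EW; have [_ <-] := D (row i W) (row (lift i 0) W) (row (lift i 1) W).
  rewrite (_ : (fun y => pullback _ _ _ _) = fun y => theta (stereo_inv false y)
    (col_mx (dstereo_inv false y (row (lift i 0) W))
      (dstereo_inv false y (row (lift i 1) W)))) //.
  apply/funext => y; rewrite /pullback.
  rewrite [row' i W]pair_rows mul_pair !jacobian_stereo_inv.
  by congr (theta _ (col_mx (dstereo_inv _ _ _) (dstereo_inv _ _ _)));
    apply/rowP => j; rewrite !mxE.
under eq_bigr do rewrite DW.
rewrite /octonion_form crossE !wE.
pose F i j l := scalar_prod (cprod (e i) (e j)) (e l).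
have S (i j l : 'I_3) (i' j' l' : 'I_7) : val i = val i' -> val j = val j' ->
    val l = val l' -> scalar_prod (cprod (e (m i)) (e (m j))) (e (m l)) = F i' j' l'.
  by move=> ii jj ll; congr F; apply: val_inj.
rewrite !big_ord_recl big_ord0 (S _ _ _ (o7 0) (o7 1) (o7 2)) //.
rewrite (S _ _ _ (o7 1) (o7 0) (o7 2)) // (S _ _ _ (o7 2) (o7 0) (o7 1)) //.
have F201 : F (o7 2) (o7 0) (o7 1) = F (o7 0) (o7 1) (o7 2).
  by rewrite /F sp_cprod_cyc.
have F102 : F (o7 1) (o7 0) (o7 2) = - F (o7 0) (o7 1) (o7 2).
  by rewrite /F cprodC spNl.
have F012 : F (o7 0) (o7 1) (o7 2) = 1.
  rewrite /F /scalar_prod sum7; have [-> -> -> _ _] := cprod_coords (e (o7 0)) (e (o7 1)).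
  by rewrite !mxE /=; ring.
rewrite F201 F102 F012 /= /bump /= !(expr0, expr1, sqrrN, expr1n) => E.
by lra.
Qed.

End Potential.

Section HDW.
Context {R : realType}.
Implicit Types (p u v : 'rV[R]_7).

Lemma derivation_tangent (D : 'M[R]_7) p : derivation D -> scalar_prod (p *m D) p = 0.
Proof.
move=> [skew _]; have := skew p p; rewrite [X in _ = - X]spC => /eqP.
by rewrite -addr_eq0 -mulr2n -mulr_natl mulf_eq0 pnatr_eq0 => /eqP.
Qed.

(** In a chart, the vector field [p |-> p *m D] has quadratic polynomial
    coefficients. *)
Lemma Ck_field_coord (b : bool) (D : 'M[R]_7) k i :
  Ck k (fun x : 'rV[R]_6 =>
          dstereo b (stereo_inv b x) (stereo_inv b x *m D) 0 i : R).
Proof.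
pose P (x : 'rV[R]_6) : 'rV[R]_7 :=
  lift7 (2 *: x) ((-1) ^+ b * (scalar_prod x x + 1 - 2)).
have CX j : Ck k (fun x : 'rV[R]_6 => x 0 j : R) by apply: Ck_coord; exact: Ck_id.
have CP j : Ck k (fun x => P x 0 j : R).
  have [{}j ->|{}j ->] := @split_ordP 6 1 j.
    under eq_fun do rewrite /P lift7El mxE.
    by apply: CkM => //; exact: Ck_cst.
  under eq_fun do rewrite /P lift7Er.
  apply: CkM; first exact: Ck_cst.
  apply: CkD; last exact: Ck_cst.
  apply: CkD; last exact: Ck_cst.
  by apply: (@Ck_sum _ _ _ R^o) => l; exact: CkM.
have CPD j : Ck k (fun x => (P x *m D) 0 j : R).
  under eq_fun do rewrite mxE.
  apply: (@Ck_sum _ _ _ R^o) => l; apply: CkM => //; exact: Ck_cst.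
have -> : (fun x : 'rV[R]_6 =>
          dstereo b (stereo_inv b x) (stereo_inv b x *m D) 0 i : R)
  = fun x => 2^-1 * ((P x *m D) 0 (lshift 1 i)
                + (-1) ^+ b * (P x *m D) 0 ord_max * x 0 i).
  apply/funext => x; rewrite /dstereo chart_denom_inv horiz_stereo_inv.
  rewrite stereo_invE -/(P x) -scalemxAl heightZ horizZ.
  move: (P x *m D) => w; rewrite !mxE.
  have q0 : scalar_prod x x + 1 != 0 by rewrite gt_eqF // ltr_wpDl ?sp_ge0.
  rewrite /height; field.
  exact: q0.
apply: CkM; first exact: Ck_cst.
apply: CkD => //; apply: CkM => //; apply: CkM => //; exact: Ck_cst.
Qed.

(** The two fields are expanded in the coordinate fields of the chart: by
    multilinearity the pairing is a sum of products of their coefficients with the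
    coordinate expressions of the form. *)
Lemma smooth_pairing (a : dform R 2 7) (D1 D2 : 'M[R]_7) (b : bool) :
  derivation D1 -> derivation D2 -> sphere_form a ->
  smooth (fun x : 'rV[R]_6 =>
    a (stereo_inv b x) (col_mx (stereo_inv b x *m D1) (stereo_inv b x *m D2)) : R).
Proof.
move=> der1 der2 [alt sm] k.
pose c (D : 'M[R]_7) x i : R := dstereo b (stereo_inv b x) (stereo_inv b x *m D) 0 i.
have cE D x : derivation D -> stereo_inv b x *m D
    = \sum_i c D x i *: dstereo_inv b x (delta_mx 0 i).
  move=> derD; have := derivation_tangent (stereo_inv b x) derD.
  have nz : 1 - (-1) ^+ b * height (stereo_inv b x) != 0.
    rewrite chart_denom_inv mulf_neq0 ?invr_eq0 ?pnatr_eq0 //.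
    by rewrite gt_eqF // ltr_wpDl ?sp_ge0.
  move/(dstereoK (sphere_stereo_inv b x) nz); rewrite stereo_invK => {1}<-.
  rewrite -jacobian_stereo_inv [dstereo _ _ _]row_sum_delta mulmx_suml.
  by apply: eq_bigr => i _; rewrite -scalemxAl jacobian_stereo_inv.
have -> : (fun x : 'rV[R]_6 =>
    a (stereo_inv b x) (col_mx (stereo_inv b x *m D1) (stereo_inv b x *m D2)) : R)
  = fun x => \sum_i \sum_j c D1 x i * c D2 x j *
       pullback (stereo_inv b) a x (col_mx (delta_mx 0 i : 'rV_6) (delta_mx 0 j : 'rV_6)).
  apply/funext => x; rewrite (cE D1) // (cE D2) //.
  have T i : scalar_prod (dstereo_inv b x (delta_mx 0 i)) (stereo_inv b x) = 0.
    exact: tangent_dstereo_inv.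
  rewrite (alternating_sum (alt _ (sphere_stereo_inv b x)) _ _ _ _ T T).
  apply: eq_bigr => i _; apply: eq_bigr => j _.
  by rewrite /pullback mul_pair !jacobian_stereo_inv.
apply: (@Ck_sum _ _ _ R^o) => i; apply: (@Ck_sum _ _ _ R^o) => j.
by apply: CkM; [apply: CkM; exact: Ck_field_coord|exact: sm].
Qed.

Lemma col_mx_empty (u v : 'rV[R]_7) (w : 'M[R]_(0, 7)) :
  col_mx (col_mx u v) w = col_mx u v :> 'M[R]_(2, 7).
Proof.
apply/matrixP => i j.
rewrite -[RHS](@col_mxEu R (1 + 1) 0 7 (col_mx u v) w i j).
by congr (col_mx _ _ _ _); exact: val_inj.
Qed.

Lemma triple_rows (u v w : 'rV[R]_7) (T := col_mx (col_mx u v) w : 'M[R]_(3, 7)) :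
  [/\ row 0 T = u, row 1 T = v & row ord_max T = w].
Proof.
split.
- have -> : (0 : 'I_3) = lshift 1 (0 : 'I_2) by exact: val_inj.
  exact: etrans (rowKu (0 : 'I_2) (col_mx u v) w) (row0_pair u v).
- have -> : (1 : 'I_3) = lshift 1 (1 : 'I_2) by exact: val_inj.
  exact: etrans (rowKu (1 : 'I_2) (col_mx u v) w) (row1_pair u v).
- have -> : (ord_max : 'I_3) = rshift 2 (0 : 'I_1) by exact: val_inj.
  exact: etrans (rowKd (0 : 'I_1) (col_mx u v) w) (row_id w).
Qed.

Section Field.
Variable theta : dform R 2 7.
Hypotheses (theta_form : sphere_form theta)
  (theta_potential : sphere_form_eq (sphere_d theta) octonion_form)
  (theta_invariant : G2_invariant theta).
Variables D1 D2 : 'M[R]_7.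
Hypotheses (der1 : derivation D1) (der2 : derivation D2)
  (comm : D1 *m D2 = D2 *m D1).

Let ham p : R := - theta p (col_mx (p *m D1) (p *m D2)).

(** By [potential_explicit] the Hamiltonian is, up to the factor [- 1 / 3], the
    cubic form [<p x D1 p, D2 p>]. By the derivation property the three terms of
    its differential are [<D1 p x D2 p, v>], up to corrections [<p x v, D1 D2 p>] and
    [- <p x v, D2 D1 p>] in two of them, which cancel because [D1] and [D2] commute. *)
Lemma derive_hamiltonian (b : bool) p v : sphere R p ->
  1 - (-1) ^+ b * height p != 0 -> scalar_prod v p = 0 ->
  'D_(dstereo b p v) (fun y => ham (stereo_inv b y)) (stereo b p)
  = - scalar_prod (cprod (p *m D1) (p *m D2)) v.
Proof.
move=> pp p0 vp; set x := stereo b p.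
have D := is_derive_stereo_inv b x (dstereo b p v).
rewrite dstereoK // in D.
have -> : (fun y => ham (stereo_inv b y)) = fun y =>
    scalar_prod (cprod (stereo_inv b y) (stereo_inv b y *m D1))
      (stereo_inv b y *m D2) * - 3^-1.
  apply/funext => y; rewrite /ham potential_explicit ?derivation_tangent //.
    by rewrite mulrN mulrC.
  exact: sphere_stereo_inv.
have [_ ->] := is_derive_prodr (- 3^-1)
  (is_derive_sp (is_derive_cprod D (is_derive_mulmxr D1 D)) (is_derive_mulmxr D2 D)).
rewrite /x stereoK //.
have [skew1 lei1] := der1; have [skew2 lei2] := der2.
set F := scalar_prod (cprod (p *m D1) (p *m D2)) v.
have E1 : scalar_prod (cprod v (p *m D1)) (p *m D2) = F by rewrite sp_cprod_cyc.
have E2 : scalar_prod (cprod p (v *m D1)) (p *m D2)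
    = F - scalar_prod (cprod p v) (p *m (D2 *m D1)).
  have := skew1 (cprod p v) (p *m D2); rewrite lei1 spDl mulmxA => /(canRL (addKr _)) ->.
  by congr (_ - _); rewrite (cprodC (p *m D1)) spNl opprK.
have E3 : scalar_prod (cprod p (p *m D1)) (v *m D2)
    = F + scalar_prod (cprod p v) (p *m (D1 *m D2)).
  have := skew2 (cprod p (p *m D1)) v; rewrite lei2 spDl mulmxA.
  rewrite (cprodC (p *m D2)) spNl -/F => E.
  have -> : scalar_prod (cprod p v) (p *m D1 *m D2)
      = - scalar_prod (cprod p (p *m D1 *m D2)) v.
    by rewrite sp_cprod_skew spC.
  by apply: oppr_inj; rewrite -E opprB addrC.
by rewrite spDl E1 E2 E3 comm; field.
Qed.

Lemma hamiltonian_form : sphere_form (form_of_fun ham).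
Proof.
split=> [p _|b v k]; first by split=> [[]|[]].
have -> : (fun x => pullback (stereo_inv b) (form_of_fun ham) x v) = fun x => -1 *
    theta (stereo_inv b x) (col_mx (stereo_inv b x *m D1) (stereo_inv b x *m D2)).
  by apply/funext => x; rewrite mulN1r.
by apply: CkM; [exact: Ck_cst|exact: smooth_pairing].
Qed.

Lemma sphere_d_fun (f : 'rV[R]_7 -> R) p (v : 'M[R]_(1, 7)) : sphere R p ->
  sphere_d (form_of_fun f) p v =
  'D_(dstereo (0 < p 0 ord_max) p v) (fun y => f (stereo_inv (0 < p 0 ord_max) y))
    (stereo (0 < p 0 ord_max) p).
Proof.
move=> pp; rewrite /sphere_d {1}/pullback /ext_d big_ord_recl big_ord0 addr0.
rewrite expr0 mul1r -[v in RHS]row_id -jacobian_stereo //.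
exact: chart_at_defined.
Qed.

Lemma hamiltonian_d p (v : 'M[R]_(1, 7)) : sphere R p -> tangent p v ->
  octonion_form p (col_mx (col_mx (p *m D1) (p *m D2)) v)
  = - sphere_d (form_of_fun ham) p v.
Proof.
move=> pp /tangent1 vp; rewrite sphere_d_fun // derive_hamiltonian //; last first.
  exact: chart_at_defined.
rewrite opprK /octonion_form crossE; congr (scalar_prod (cprod _ _) _).
- by have [-> _ _] := triple_rows (p *m D1) (p *m D2) v.
- by have [_ -> _] := triple_rows (p *m D1) (p *m D2) v.
- by have [_ _ ->] := triple_rows (p *m D1) (p *m D2) v.
Qed.

Lemma bivector_field :
  sphere_bivector_field (fun p => wedge_vectors (p *m D1) (p *m D2)).
Proof.
split=> [p pp|a af].
  exists [:: (p *m D1, p *m D2)]; split.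
    move=> XY; rewrite inE => /eqP -> /=.
    by split; apply/tangent1; exact: derivation_tangent.
  by apply/funext => b; rewrite big_seq1.
split=> [p _|b v k]; first by split=> [[]|[]].
exact: smooth_pairing.
Qed.

End Field.
End HDW.

(** * Common eigenvectors *)

Section CommonEigenvectors.
Context {R : realType}.

Lemma Ck_mulmxr (V : normedModType R) k m n (f : V -> 'rV[R]_m) (A : 'M[R]_(m, n)) :
  Ck k f -> Ck k (fun x => f x *m A).
Proof.
move=> Cf; under eq_fun do rewrite mulmx_sum_row.
by apply: Ck_sum => i; apply: CkZl; exact: Ck_coord.
Qed.

Lemma Ck_sp (V : normedModType R) k n (f g : V -> 'rV[R]_n) :
  Ck k f -> Ck k g -> Ck k (fun x => scalar_prod (f x) (g x) : R).
Proof.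
move=> Cf Cg; apply: (@Ck_sum _ _ _ R^o) => i.
by apply: CkM; exact: Ck_coord.
Qed.

Lemma closed_fiber (T : topologicalType) (W : normedModType R) (f : T -> W) y :
  continuous f -> closed [set x | f x = y].
Proof.
move=> cf; have cy : closed [set y].
  apply: accessible_closed_set1; apply: hausdorff_accessible.
  exact: norm_hausdorff.
exact: (continuous_closedP f).1 cf _ cy.
Qed.

(** The maximum of the quadratic form of a symmetric operator on the unit sphere
    of an invariant subspace is attained at an eigenvector. The subspace is the
    kernel of [K]. *)
Lemma symmetric_eigenvector n m (A : 'M[R]_n) (K : 'M[R]_(n, m)) :
  A^T = A -> (exists2 v : 'rV[R]_n, v *m K = 0 & v != 0) ->
  (forall v : 'rV[R]_n, v *m K = 0 -> v *m A *m K = 0) ->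
  exists (v : 'rV[R]_n) (l : R),
    [/\ v *m K = 0, scalar_prod v v = 1 & v *m A = l *: v].
Proof.
move=> symA [v0 v0K v00] stable.
pose S : set 'rV[R]_n := [set v | v *m K = 0 /\ scalar_prod v v = 1].
pose Q (v : 'rV[R]_n) : R := scalar_prod (v *m A) v.
have normalize (v : 'rV[R]_n) : v *m K = 0 -> v != 0 ->
    S ((Num.sqrt (scalar_prod v v))^-1 *: v).
  move=> vK v_neq0; split; first by rewrite -scalemxAl vK scaler0.
  have r0 : Num.sqrt (scalar_prod v v) != 0 by rewrite gt_eqF // sqrtr_gt0 sp_gt0.
  rewrite spZl spZr -[X in _ * (_ * X)]sqr_sqrtr ?sp_ge0 //; field; exact: r0.
have S0 : S !=set0 by exists ((Num.sqrt (scalar_prod v0 v0))^-1 *: v0); exact: normalize.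
have cS : compact S.
  apply: bounded_closed_compact.
    exists 1; split => // M M1 v [_ v1]; apply: le_trans (ltW M1).
    rewrite [leLHS]/Num.Def.normr /= mx_normrE; apply: bigmax_le => // -[i j] _ /=.
    rewrite ord1 -ler_sqr ?nnegrE // expr1n real_normK ?num_real // -v1.
    rewrite /scalar_prod (bigD1 j) //= expr2 lerDl.
    by apply: sumr_ge0 => k _; rewrite -expr2 sqr_ge0.
  have -> : S = [set v | v *m K = 0] `&` [set v | scalar_prod v v = 1] by [].
  apply: closedI.
    apply: closed_fiber; apply: (@Ck_continuous _ _ 0%N).
    by apply: Ck_mulmxr; exact: Ck_id.
  apply: (@closed_fiber _ R^o); apply: (@Ck_continuous _ _ 0%N).
  by apply: Ck_sp; exact: Ck_id.
have cQ : {within S, continuous Q}.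
  apply: continuous_subspaceT; apply: (@Ck_continuous _ _ 0%N R^o).
  by apply: Ck_sp; last exact: Ck_id; apply: Ck_mulmxr; exact: Ck_id.
have [v vS vmax] := compact_EVT_max S0 cS cQ.
move/set_mem: vS => [vK v1]; set l := Q v in vmax.
have bound (w : 'rV[R]_n) : w *m K = 0 -> Q w <= l * scalar_prod w w.
  move=> wK; have [->|w0] := eqVneq w 0; first by rewrite /Q mul0mx !sp0l mulr0.
  have := vmax _ (mem_set (normalize w wK w0)).
  rewrite /Q -scalemxAl spZl spZr mulrA -expr2 exprVn sqr_sqrtr ?sp_ge0 // mulrC.
  by rewrite ler_pdivrMr ?sp_gt0.
exists v, l; split=> //; apply/eqP; rewrite -subr_eq0; apply/eqP/sp_eq0.
set w := v *m A - l *: v; set s := scalar_prod w w.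
have wK : w *m K = 0 by rewrite mulmxBl stable // -scalemxAl vK scaler0 subr0.
pose d := l * s - Q w.
have Q_line (z : 'rV[R]_n) t :
    Q (v + t *: z) = l + 2 * t * scalar_prod (v *m A) z + t ^+ 2 * Q z.
  rewrite /Q mulmxDl -scalemxAl !(spDl, spDr, spZl, spZr) -/l.
  have -> : scalar_prod (z *m A) v = scalar_prod (v *m A) z.
    by rewrite sp_adj symA spC.
  rewrite [in RHS]/l /Q; ring.
have N_line (z : 'rV[R]_n) t : scalar_prod (v + t *: z) (v + t *: z)
    = 1 + 2 * t * scalar_prod v z + t ^+ 2 * scalar_prod z z.
  by rewrite !(spDl, spDr, spZl, spZr) v1 (spC z v); ring.
have Es : s = scalar_prod (v *m A) w - l * scalar_prod v w.
  by rewrite /s [in LHS]/w spBl spZl.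
have quad (t : R) : 2 * t * s <= t ^+ 2 * d.
  have := bound (v + t *: w); rewrite mulmxDl -scalemxAl vK wK scaler0 addr0.
  move=> /(_ erefl); rewrite Q_line N_line -/s /d => le0.
  have -> : 2 * t * s = 2 * t * scalar_prod (v *m A) w - l * (2 * t * scalar_prod v w).
    by rewrite Es; ring.
  rewrite mulrBr; lra.
have s0 : 0 <= s by exact: sp_ge0.
apply/eqP; rewrite eq_le s0 andbT leNgt; apply/negP => sgt.
have dgt : 0 < d.
  have := quad 1; rewrite expr1n mul1r mulr1 => /(lt_le_trans _); apply.
  by rewrite mulr_gt0.
have := quad (s / d); rewrite (_ : _ ^+ 2 * d = s / d * s); last by field; rewrite gt_eqF.
have : 0 < s / d * s by rewrite mulr_gt0 ?divr_gt0.
by rewrite -mulrA; lra.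
Qed.

(** [B] preserves the eigenspaces of [A]. *)
Lemma common_symmetric_eigenvector n m (A B : 'M[R]_n) (K : 'M[R]_(n, m)) :
  A^T = A -> B^T = B -> A *m B = B *m A ->
  (exists2 v : 'rV[R]_n, v *m K = 0 & v != 0) ->
  (forall v : 'rV[R]_n, v *m K = 0 -> v *m A *m K = 0) ->
  (forall v : 'rV[R]_n, v *m K = 0 -> v *m B *m K = 0) ->
  exists (v : 'rV[R]_n) (l mu : R),
    [/\ v *m K = 0, scalar_prod v v = 1, v *m A = l *: v & v *m B = mu *: v].
Proof.
move=> symA symB AB K0 KA KB.
have [v [l [vK v1 vA]]] := symmetric_eigenvector symA K0 KA.
pose K' := row_mx K (A - l%:M).
have K'P (w : 'rV[R]_n) : w *m K' = 0 <-> w *m K = 0 /\ w *m A = l *: w.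
  rewrite mul_mx_row -[0 in X in X <-> _](@row_mx0 _ 1 m n); split.
    by move/eq_row_mx => [wK /eqP]; rewrite mulmxBr mul_mx_scalar subr_eq0 => /eqP.
  by case=> -> wA; rewrite mulmxBr mul_mx_scalar wA subrr.
have [||w [mu [/K'P[wK wA] w1 wB]]] := symmetric_eigenvector symB (K := K').
- exists v; first exact/K'P.
  by apply/eqP => v0; move/eqP: v1; rewrite v0 sp0l eq_sym oner_eq0.
- move=> w /K'P[wK wA]; apply/K'P; split; first exact: KB.
  by rewrite -mulmxA -AB mulmxA wA -scalemxAl.
by exists w, l, mu; split.
Qed.

Lemma symmetric_mxP n (A : 'M[R]_n) :
  (forall u v, scalar_prod (u *m A) v = scalar_prod u (v *m A)) -> A^T = A.
Proof.
move=> sA; apply/row_matrixP => i; rewrite !rowE; apply: sp_inj => v.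
by rewrite spC -sp_adj sA spC.
Qed.

(** Over the complex numbers [D1^2 + D2^2] factors as [(D1 + i D2) (D1 - i D2)],
    and a skew matrix of odd size is singular. Hence [D1^2 + D2^2] has a kernel, and
    since [<v D1^2 + v D2^2, v> = - |v D1|^2 - |v D2|^2] its kernel is killed by both. *)
Lemma common_kernel n (D1 D2 : 'M[R]_n) : odd n ->
  D1^T = - D1 -> D2^T = - D2 -> D1 *m D2 = D2 *m D1 ->
  exists2 v : 'rV[R]_n, scalar_prod v v = 1 & v *m D1 = 0 /\ v *m D2 = 0.
Proof.
move=> oddn skew1 skew2 comm.
pose C : numClosedFieldType := complex.complex R.
pose f : {rmorphism R -> C} := complex.real_complex R.
pose M := map_mx f D1 + 'i *: map_mx f D2.
pose N := map_mx f D1 - 'i *: map_mx f D2.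
have MN : M *m N = map_mx f (D1 *m D1 + D2 *m D2).
  rewrite mulmxDl !mulmxBr -!scalemxAl -!scalemxAr scalerA -expr2 sqrCi scaleN1r.
  rewrite -!map_mxM comm opprK map_mxD addrA; congr (_ + _).
  by rewrite subrK.
have detM : \det M = 0.
  have : M^T = - M.
    have sk (D : 'M[R]_n) i j : D^T = - D -> D j i = - D i j.
      by move=> /matrixP/(_ i j); rewrite !mxE.
    apply/matrixP => i j; rewrite !mxE (sk _ _ _ skew1) (sk _ _ _ skew2) !rmorphN.
    by rewrite mulrN -opprD.
  move/(congr1 determinant); rewrite det_tr -scaleN1r detZ -signr_odd oddn expr1 mulN1r.
  by move/eqP; rewrite -addr_eq0 -mulr2n -mulr_natl mulf_eq0 pnatr_eq0 => /eqP.
have := congr1 determinant MN; rewrite det_mulmx [X in X * _]detM mul0r => /esym.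
rewrite det_map_mx => /eqP; rewrite fmorph_eq0 => /det0P[v v0].
rewrite mulmxDr !mulmxA => vD.
have sq D : D^T = - D -> scalar_prod (v *m D *m D) v = - scalar_prod (v *m D) (v *m D).
  by move=> skewD; rewrite sp_adj skewD mulmxN spNr.
have := congr1 (fun w => scalar_prod w v) vD; rewrite spDl !sq // sp0l -opprD.
move/eqP; rewrite oppr_eq0 paddr_eq0 ?sp_ge0 // => /andP[/eqP/sp_eq0 vD1 /eqP/sp_eq0 vD2].
exists ((Num.sqrt (scalar_prod v v))^-1 *: v); last by rewrite -!scalemxAl vD1 vD2 !scaler0.
have r0 : Num.sqrt (scalar_prod v v) != 0 by rewrite gt_eqF // sqrtr_gt0 sp_gt0.
by rewrite spZl spZr -[X in _ * (_ * X)]sqr_sqrtr ?sp_ge0 //; field; exact: r0.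
Qed.

End CommonEigenvectors.

(** * A frame adapted to two commuting derivations *)

Section AdaptedFrame.
Context {R : realType}.
Implicit Types (a b c u v : 'rV[R]_7).

Definition cprod_mx a : 'M[R]_7 := \matrix_(i < 7) cprod a (delta_mx 0 i).

Lemma mul_cprod_mx a u : u *m cprod_mx a = cprod a u.
Proof.
rewrite mulmx_sum_row [in RHS](row_sum_delta u) cprod_sumr.
by apply: eq_bigr => i _; rewrite rowK cprodZr.
Qed.

Lemma derivation_skew_mx (D : 'M[R]_7) : derivation D -> D^T = - D.
Proof.
move=> [skew _]; apply/row_matrixP => i; rewrite !rowE; apply: sp_inj => v.
by rewrite spC -sp_adj skew mulmxN spNl spC.
Qed.

Lemma sum3 (W : nmodType) (F : 'I_3 -> W) : \sum_k F k = F 0 + F 1 + F ord_max.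
Proof.
rewrite !big_ord_recl big_ord0 addr0 addrA.
by do !congr (_ + _); congr F; apply: val_inj.
Qed.

Lemma orthogonal_mulmx k (U : 'M[R]_(k, 7)) u :
  u *m U^T = 0 <-> forall i, scalar_prod u (row i U) = 0.
Proof.
have E i : (u *m U^T) 0 i = scalar_prod u (row i U).
  by rewrite mxE; apply: eq_bigr => j _; rewrite !mxE.
split=> [uU i|uU]; first by rewrite -E uU mxE.
by apply/rowP => i; rewrite E uU mxE.
Qed.

Section TwoDerivations.
Variables D1 D2 : 'M[R]_7.
Hypotheses (der1 : derivation D1) (der2 : derivation D2)
  (comm : D1 *m D2 = D2 *m D1).

Section FixedAxis.
Variable a : 'rV[R]_7.
Hypotheses (aa : scalar_prod a a = 1) (aD1 : a *m D1 = 0) (aD2 : a *m D2 = 0).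

(** [u |-> a x u] is the complex structure on the orthogonal of [a]; the
    derivations killing [a] are linear for it. *)
Lemma derivation_axis D u : derivation D -> a *m D = 0 ->
  cprod a u *m D = cprod a (u *m D).
Proof. by move=> [_ lei] aD; rewrite lei aD cprod0l add0r. Qed.

Lemma derivation_axis_orth D u : derivation D -> a *m D = 0 ->
  scalar_prod a (u *m D) = 0.
Proof. by move=> [skew _] aD; rewrite -[LHS]opprK -skew aD sp0l oppr0. Qed.

Lemma axis_symmetric D : derivation D -> a *m D = 0 ->
  (D *m cprod_mx a)^T = D *m cprod_mx a.
Proof.
move=> derD aD; apply: symmetric_mxP => u v; rewrite !mulmxA !mul_cprod_mx.
by rewrite sp_cprod_skew derD.1 opprK derivation_axis.
Qed.

Lemma axis_eigenvector D u (l : R) : derivation D -> a *m D = 0 ->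
  u *m (D *m cprod_mx a) = l *: u -> u *m D = (- l) *: cprod a u.
Proof.
move=> derD aD; rewrite mulmxA mul_cprod_mx => E.
by rewrite scaleNr -cprodZr -E cprod_sq ?opprK // derivation_axis_orth.
Qed.

(** If [U] is a family of at most six eigenvectors, the orthogonal of its span is
    a nonzero invariant subspace. *)
Lemma orthogonal_common_eigenvector k (U : 'M[R]_(k, 7)) : (k < 7)%N ->
  (forall i, exists l m : R,
     row i U *m (D1 *m cprod_mx a) = l *: row i U /\
     row i U *m (D2 *m cprod_mx a) = m *: row i U) ->
  exists (v : 'rV[R]_7) (l m : R),
    [/\ scalar_prod v v = 1, forall i, scalar_prod v (row i U) = 0,
        v *m D1 = l *: cprod a v & v *m D2 = m *: cprod a v].
Proof.
move=> k7 eig.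
have [v0 [v01 v0U]] := exists_orthogonal U k7.
have [||||v [l [m [vU v1 vA vB]]]] :=
    common_symmetric_eigenvector (K := U^T) (axis_symmetric der1 aD1) (axis_symmetric der2 aD2).
- rewrite -!mulmxA; apply/row_matrixP => i; rewrite !rowE !mulmxA !mul_cprod_mx.
  rewrite !(derivation_axis _ der1) // !(derivation_axis _ der2) // -!mulmxA.
  by rewrite comm.
- exists v0; first exact/orthogonal_mulmx.
  by apply/eqP => v00; move/eqP: v01; rewrite v00 sp0l eq_sym oner_eq0.
- move=> v /orthogonal_mulmx vU; apply/orthogonal_mulmx => i.
  have [l [_ [El _]]] := eig i.
  by rewrite sp_adj axis_symmetric // El spZr vU mulr0.
- move=> v /orthogonal_mulmx vU; apply/orthogonal_mulmx => i.
  have [_ [m [_ Em]]] := eig i.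
  by rewrite sp_adj axis_symmetric // Em spZr vU mulr0.
exists v, (- l), (- m); split=> //; first exact/orthogonal_mulmx.
  exact: axis_eigenvector.
exact: axis_eigenvector.
Qed.

End FixedAxis.

(** The axis [a] is a common kernel vector; [b] and [c] are common eigenvectors of
    the symmetric operators [u |-> a x (u D)], and [c] is found in the orthogonal of
    the quaternions of [a] and [b]. *)
Lemma adapted_triple : exists a b c (l1 m1 l2 m2 : R),
  [/\ basic_triple a b c, a *m D1 = 0 /\ a *m D2 = 0,
      b *m D1 = l1 *: cprod a b /\ b *m D2 = m1 *: cprod a b
    & c *m D1 = l2 *: cprod a c /\ c *m D2 = m2 *: cprod a c].
Proof.
have [a aa [aD1 aD2]] := common_kernel (isT : odd 7) (derivation_skew_mx der1)
  (derivation_skew_mx der2) comm.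
have eig_a : exists l m : R, a *m (D1 *m cprod_mx a) = l *: a /\
    a *m (D2 *m cprod_mx a) = m *: a.
  by exists 0, 0; rewrite !mulmxA aD1 aD2 !mul0mx !scale0r.
have [|b [l1 [m1 [bb bU bD1 bD2]]]] := orthogonal_common_eigenvector aa aD1 aD2 (isT : (1 < 7)%N) (U := a).
  by move=> i; rewrite ord1 row_id.
have ab : scalar_prod a b = 0 by have := bU 0; rewrite row_id spC.
have Jb : cprod a (cprod a b) = - b by exact: cprod_sq.
pose U : 'M[R]_(3, 7) := \matrix_(i < 3) nth 0 [:: a; b; cprod a b] i.
have [|c [l2 [m2 [cc cU cD1 cD2]]]] := orthogonal_common_eigenvector aa aD1 aD2 (isT : (3 < 7)%N) (U := U).
  move=> i; rewrite rowK; move: i; apply: ord3_ind => //=.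
    exists (- l1), (- m1); rewrite !mulmxA !mul_cprod_mx bD1 bD2 !cprodZr Jb.
    by rewrite !scalerN !scaleNr.
  exists (- l1), (- m1); rewrite !mulmxA !mul_cprod_mx.
  rewrite !derivation_axis // bD1 bD2 !cprodZr Jb !cprodNr !scaleNr.
  by rewrite !scalerN.
have ca : scalar_prod c a = 0 by have := cU 0; rewrite rowK.
have cb : scalar_prod c b = 0 by have := cU 1; rewrite rowK.
have cab : scalar_prod c (cprod a b) = 0 by have := cU ord_max; rewrite rowK.
exists a, b, c, l1, m1, l2, m2; split=> //.
by split; split; rewrite // spC.
Qed.

(** The two derivations act as simultaneous infinitesimal rotations, with angular
    velocities [l k] and [m k], in planes that are orthogonal to each other. The
    velocities have sum zero, which is the reason why the torus through [p] has
    dimension at most two. *)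
Definition rotation_decomposition (p q0 : 'rV[R]_7) (A B : 'I_3 -> 'rV[R]_7)
    (l m : 'I_3 -> R) : Prop :=
  [/\ p = q0 + \sum_k A k, q0 *m D1 = 0 /\ q0 *m D2 = 0,
      forall k, [/\ A k *m D1 = l k *: B k, B k *m D1 = - (l k *: A k),
                  A k *m D2 = m k *: B k & B k *m D2 = - (m k *: A k)],
      l ord_max = - (l 0 + l 1) /\ m ord_max = - (m 0 + m 1)
    & [/\ forall j k, scalar_prod (A j) (B k) = 0,
         forall j k, j != k -> scalar_prod (A j) (A k) = 0,
         forall j k, j != k -> scalar_prod (B j) (B k) = 0
       & forall k, scalar_prod (B k) (B k) = scalar_prod (A k) (A k)]].

(** The planes are those of [b], [c] and [b x c] with their products by [a]; the
    Leibniz rule makes the velocity on [b x c] opposite to the sum of the other two. *)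
Lemma rotation_decomposition_exists p :
  exists q0 A B l m, rotation_decomposition p q0 A B l m.
Proof.
have [a [b [c [l1 [m1 [l2 [m2 [abc [aD1 aD2] [bD1 bD2] [cD1 cD2]]]]]]]]] := adapted_triple.
pose F := frame a b c.
have O i j : scalar_prod (row i F) (row j F) = (i == j)%:R.
  have := frame_orthonormal abc => /matrixP/(_ i j); rewrite !mxE => <-.
  by apply: eq_bigr => k _; rewrite !mxE.
case: (abc) => [[aa bb cc] [ab ac bc dc]].
pose U (k : 'I_3) : 'rV[R]_7 := nth 0 [:: b; c; cprod b c] k.
pose W k := cprod a (U k).
pose fu (k : 'I_3) : 'I_7 := nth (o7 0) [:: o7 1; o7 3; o7 5] k.
pose fw (k : 'I_3) : 'I_7 := nth (o7 0) [:: o7 2; o7 4; o7 6] k.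
have EU k : U k = row (fu k) F by rewrite rowK; move: k; apply: ord3_ind.
have EW k : W k = row (fw k) F by rewrite rowK; move: k; apply: ord3_ind.
have UU j k : scalar_prod (U j) (U k) = (j == k)%:R.
  by rewrite !EU O; move: j k; apply: ord3_ind; apply: ord3_ind.
have WW j k : scalar_prod (W j) (W k) = (j == k)%:R.
  by rewrite !EW O; move: j k; apply: ord3_ind; apply: ord3_ind.
have UW j k : scalar_prod (U j) (W k) = 0.
  by rewrite EU EW O; move: j k; apply: ord3_ind; apply: ord3_ind.
have aU k : scalar_prod a (U k) = 0.
  have -> : a = row (o7 0) F by rewrite rowK.
  by rewrite EU O; move: k; apply: ord3_ind.
have aW k : cprod a (W k) = - U k by exact: cprod_sq.
pose l (k : 'I_3) : R := nth 0 [:: l1; l2; - (l1 + l2)] k.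
pose m (k : 'I_3) : R := nth 0 [:: m1; m2; - (m1 + m2)] k.
have bcD D x y : derivation D -> b *m D = x *: cprod a b -> c *m D = y *: cprod a c ->
    cprod b c *m D = - (x + y) *: cprod a (cprod b c).
  move=> [_ lei] bD cD; rewrite lei bD cD cprodZl cprodZr.
  have -> : cprod (cprod a b) c = - cprod a (cprod b c).
    by rewrite cprodC cprod_swap ?(spC c) // (cprodC c) cprodNr opprK.
  have -> : cprod b (cprod a c) = - cprod a (cprod b c) by rewrite cprod_swap // spC.
  by rewrite !scalerN -opprD -scalerDl scaleNr.
have UD1 k : U k *m D1 = l k *: W k by move: k; apply: ord3_ind => //; exact: bcD.
have UD2 k : U k *m D2 = m k *: W k by move: k; apply: ord3_ind => //; exact: bcD.
have WD D x k : derivation D -> a *m D = 0 -> U k *m D = x *: W k ->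
    W k *m D = - (x *: U k).
  by move=> derD aD UD; rewrite derivation_axis // UD cprodZr aW scalerN.
pose x k := scalar_prod p (U k); pose y k := scalar_prod p (W k).
exists (scalar_prod p a *: a), (fun k => x k *: U k + y k *: W k),
  (fun k => x k *: W k - y k *: U k), l, m; split.
- have pE : p = \sum_i scalar_prod p (row i F) *: row i F.
    rewrite -[LHS]mulmx1 -(frame_tr_orthonormal abc) mulmxA mulmx_sum_row.
    apply: eq_bigr => i _; congr (_ *: _); rewrite mxE.
    by apply: eq_bigr => j _; rewrite !mxE.
  have [r0 r1 r2 r3] := frame_rows a b c.
  rewrite [LHS]pE sum7 sum3 r0 -!addrA /x /y !EU !EW.
  by do !congr (_ + _).
- by rewrite -!scalemxAl aD1 aD2 !scaler0.
- move=> k; rewrite !mulmxDl !mulNmx -!scalemxAl UD1 UD2 (WD D1 (l k)) // (WD D2 (m k)) //.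
  move: (x k) (y k) (l k) (m k) (U k) (W k) => x' y' l' m' u w.
  by split; apply/rowP => i; rewrite !mxE; ring.
- by [].
- split=> [j k|j k jk|j k jk|k];
    rewrite ?(spDl, spDr, spNl, spNr, spZl, spZr) ?UU ?WW ?UW ?(spC (W _)) ?UW ?(negbTE jk) ?eqxx.
  + by case: (eqVneq j k) => [->|_] /=; ring.
  + by rewrite /=; ring.
  + by rewrite /=; ring.
  + by rewrite /=; ring.
Qed.

End TwoDerivations.

End AdaptedFrame.

(** * Flows on the sphere as rotations *)

Section Flows.
Context {R : realType}.
Variable n : nat.

(** The point of the orbit of [q0 + \sum_k A k] under independent rotations of the
    planes spanned by the [A k] and the [B k]. *)
Definition rotate (q0 : 'rV[R]_7) (A B : 'I_n -> 'rV[R]_7) (th : 'I_n -> R) :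
    'rV[R]_7 :=
  q0 + \sum_k (cos (th k) *: A k + sin (th k) *: B k).

Lemma is_derive_rotate q0 A B (th l : 'I_n -> R) (t : R) :
  is_derive t 1 (fun s : R => rotate q0 A B (fun k => th k + s * l k))
    (\sum_k l k *: (cos (th k + t * l k) *: B k - sin (th k + t * l k) *: A k)).
Proof.
have Da k : is_derive t (1 : R) (fun s : R => th k + s * l k) (l k).
  have Dc : is_derive t (1 : R) (fun=> th k : R) (0 : R) by exact: is_derive_cst.
  apply: is_derive_eq (is_deriveD Dc (is_derive_prodr (l k) (is_derive_id t 1))) _.
  by rewrite add0r mul1r.
have D0 : is_derive t (1 : R) (fun=> q0) (0 : 'rV[R]_7) by exact: is_derive_cst.
rewrite -[X in is_derive _ _ _ X]add0r.
apply: (is_deriveD D0); apply: is_derive_finsum => k.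
have Dcos := is_derive1_comp (f := cos) (g := fun s => th k + s * l k) (is_derive_cos (th k + t * l k)) (Da k).
have Dsin := is_derive1_comp (f := sin) (g := fun s => th k + s * l k) (is_derive_sin (th k + t * l k)) (Da k).
apply: is_derive_eq (is_deriveD (is_derive_scalel (A k) Dcos) (is_derive_scalel (B k) Dsin)) _.
by apply/rowP => i; rewrite !mxE; ring.
Qed.

End Flows.

Section FlowSphere.
Context {R : realType}.
Variable xi : 'M[R]_7.

Lemma rotation_field q0 n (A B : 'I_n -> 'rV[R]_7) (l th : 'I_n -> R) :
  q0 *m xi^T = 0 ->
  (forall k, A k *m xi^T = l k *: B k /\ B k *m xi^T = - (l k *: A k)) ->
  rotate q0 A B th *m xi^T
  = \sum_k l k *: (cos (th k) *: B k - sin (th k) *: A k).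
Proof.
move=> q0D ABD; rewrite mulmxDl q0D add0r mulmx_suml; apply: eq_bigr => k _.
have [AD BD] := ABD k; rewrite mulmxDl -!scalemxAl AD BD.
by apply/rowP => i; rewrite !mxE; ring.
Qed.

Hypothesis der : derivation xi^T.

Lemma skew_constant (c : R -> 'rV[R]_7) :
  (forall t : R, is_derive t 1 c (c t *m xi^T)) ->
  forall t, scalar_prod (c t) (c t) = scalar_prod (c 0) (c 0).
Proof.
move=> Dc t.
apply: (@is_derive_0_is_cst _ (fun t => scalar_prod (c t) (c t))) => s.
apply: is_derive_eq (is_derive_sp (Dc s) (Dc s)) _.
by rewrite der.1 addNr.
Qed.

(** The difference of two integral curves solves the same linear equation, so its
    norm is constant. *)
Lemma integral_curve_unique p c c' :
  integral_curve (fundamental xi) p c -> integral_curve (fundamental xi) p c' ->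
  c = c'.
Proof.
move=> [c0 Hc] [c0' Hc']; apply/funext => t; apply/eqP; rewrite -subr_eq0.
apply/eqP/sp_eq0.
have D (s : R) : is_derive s 1 (fun t => c t - c' t) ((c s - c' s) *m xi^T).
  have [_ Dc] := Hc s; have [_ Dc'] := Hc' s.
  by rewrite mulmxBl -!fundamentalE; exact: is_deriveB.
by rewrite (skew_constant D) c0 c0' subrr sp0l.
Qed.

Section Rotation.
Variables (n : nat) (q0 : 'rV[R]_7) (A B : 'I_n -> 'rV[R]_7) (l th : 'I_n -> R).
Hypotheses (axis : q0 *m xi^T = 0)
  (planes : forall k, A k *m xi^T = l k *: B k /\ B k *m xi^T = - (l k *: A k))
  (start : sphere R (rotate q0 A B th)).

Let c (t : R) := rotate q0 A B (fun k => th k + t * l k).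

Lemma rotate_integral_curve :
  integral_curve (fundamental xi) (rotate q0 A B th) c.
Proof.
have Dc (s : R) : is_derive s 1 c (c s *m xi^T).
  by rewrite (rotation_field _ axis planes); exact: is_derive_rotate.
have c0 : c 0 = rotate q0 A B th.
  by congr rotate; apply/funext => k; rewrite mul0r addr0.
split=> // s; rewrite fundamentalE; split; last exact: Dc.
by rewrite /sphere /= skew_constant // c0.
Qed.

Lemma rotate_sphere t : sphere R (rotate q0 A B (fun k => th k + t * l k)).
Proof. by have [_ /(_ t)[]] := rotate_integral_curve. Qed.

Lemma flow_rotate t :
  flow (fundamental xi) t (rotate q0 A B th)
  = rotate q0 A B (fun k => th k + t * l k).
Proof.
rewrite /flow (xget_unique _ rotate_integral_curve) // => c' c'I.
exact: integral_curve_unique c'I rotate_integral_curve.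
Qed.

End Rotation.

End FlowSphere.

(** * Angles modulo a turn *)

Section Angles.
Context {R : realType}.
Implicit Types (a b x y e : R) (z : int).

Definition turn : R := 2 * pi.

Lemma turn_gt0 : 0 < turn.
Proof. by rewrite mulr_gt0 // pi_gt0. Qed.

Lemma turn_neq0 : turn != 0.
Proof. by rewrite gt_eqF // turn_gt0. Qed.

Lemma cos_sin_turn a z :
  cos (a + turn * z%:~R) = cos a /\ sin (a + turn * z%:~R) = sin a.
Proof.
have N (n : nat) b : cos (b + turn * n%:R) = cos b /\ sin (b + turn * n%:R) = sin b.
  elim: n => [|n [IHc IHs]]; first by rewrite mulr0 addr0.
  rewrite -natr1 mulrDr mulr1 addrA {2 4}/turn mulr_natl.
  by rewrite cosD2pi sinD2pi.
case: z => n; first exact: N.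
have [<- <-] := N n.+1 (a + turn * (Negz n)%:~R).
by rewrite NegzE mulrNz mulrN -addrA addNr addr0.
Qed.

Lemma cos_eq1_turn a : cos a = 1 -> exists z, a = turn * z%:~R.
Proof.
move=> ca; pose z := Num.floor (a / turn); exists z.
have /andP[] := floor_itv (a / turn); rewrite -/z ler_pdivlMr ?turn_gt0 //.
rewrite ltr_pdivrMr ?turn_gt0 // intrD mulrDl mul1r mulrC => za az.
pose d := a - turn * z%:~R.
have cd : cos d = 1.
  by rewrite -ca -[in RHS](subrK (turn * z%:~R) a); have [-> _] := cos_sin_turn d z.
have d0 : 0 <= d by rewrite subr_ge0.
have d1 : d < turn by rewrite ltrBlDl.
have p0 := @pi_gt0 R.
have [dpi|pid] := leP d pi.
  have : d = 0 by apply: cos_inj; rewrite ?in_itv /= ?d0 ?dpi ?lexx ?(ltW p0) // cd cos0.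
  by move/eqP; rewrite subr_eq0 => /eqP.
have : turn - d = 0.
  apply: cos_inj; rewrite ?in_itv /= ?lexx ?(ltW p0) //.
    by rewrite subr_ge0 (ltW d1) /= lerBlDl /turn mulr2n mulrDl mul1r lerD2r ltW.
  rewrite cos0 -cd -[RHS]cosN; have [<- _] := cos_sin_turn (- d) 1.
  by rewrite mulr1 addrC.
by move/eqP; rewrite subr_eq0 eq_sym (lt_eqF d1).
Qed.

Lemma same_angle a b : cos a = cos b -> sin a = sin b ->
  exists z, a = b + turn * z%:~R.
Proof.
move=> cab sab; have [|z E] := @cos_eq1_turn (a - b).
  by rewrite cosB cab sab -!expr2 cos2Dsin2.
by exists z; rewrite -E addrC subrK.
Qed.

(** Pigeonhole: among the fractional parts of [0, x, ..., N x], two are closer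
    than [1 / N]. *)
Lemma small_combination x e : 0 < e -> (forall m n : int, n != 0 -> n%:~R * x != m%:~R) ->
  exists m n : int, 0 < `|n%:~R * x - m%:~R| < e.
Proof.
move=> e0 irr; pose N := (Num.truncn e^-1).+1.
have N0 : 0 < N%:R :> R by rewrite ltr0n.
have Ne : N%:R^-1 < e.
  rewrite invf_plt ?posrE //; exact: truncnS_gt.
pose fr (i : nat) : R := i%:R * x - (Num.floor (i%:R * x))%:~R.
have fr01 i : 0 <= fr i < 1.
  have /andP[] := floor_itv (i%:R * x); rewrite intrD /fr => le1 lt1.
  by rewrite subr_ge0 le1 /= ltrBlDl.
pose g0 (i : nat) : nat := Num.truncn (N%:R * fr i).
have g0_itv i : (g0 i)%:R <= N%:R * fr i < (g0 i).+1%:R.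
  by apply: truncn_itv; rewrite mulr_ge0 //; have /andP[] := fr01 i.
have g0N i : (g0 i < N)%N.
  rewrite -(ltr_nat R); have /andP[le1 _] := g0_itv i; apply: le_lt_trans le1 _.
  by rewrite -[ltRHS]mulr1 ltr_pM2l //; have /andP[] := fr01 i.
pose g (i : 'I_N.+1) : 'I_N := Ordinal (g0N i).
have /injectivePn[i [j ij gij]] : ~~ injectiveb g.
  by apply/negP => /injectiveP/leq_card; rewrite !card_ord ltnn.
have gE : g0 i = g0 j by have := congr1 val gij.
exists (Num.floor (i%:R * x) - Num.floor (j%:R * x)), (i%:Z - j%:Z).
have -> : (i%:Z - j%:Z)%:~R * x - (Num.floor (i%:R * x) - Num.floor (j%:R * x))%:~R
    = fr i - fr j by rewrite /fr !rmorphB /=; ring.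
apply/andP; split.
  rewrite normr_gt0 subr_eq0; apply/eqP => E.
  have := irr (Num.floor (i%:R * x) - Num.floor (j%:R * x)) (i%:Z - j%:Z).
  rewrite subr_eq0 eqz_nat ij => /(_ isT)/eqP; apply.
  by rewrite !rmorphB /=; move: E; rewrite /fr; lra.
apply: lt_trans Ne.
rewrite -[ltRHS]mulr1 -ltr_pdivrMl ?invr_gt0 // invrK.
have -> : N%:R * `|fr i - fr j| = `|N%:R * fr i - N%:R * fr j|.
  by rewrite -mulrBr normrM ger0_norm ?ler0n.
have /andP[] := g0_itv i; have /andP[] := g0_itv j; rewrite gE -natr1.
by move=> *; rewrite ltr_norml; apply/andP; split; lra.
Qed.

(** Kronecker's density theorem in dimension one. *)
Lemma irrational_dense x y e : 0 < e ->
  (forall m n : int, n != 0 -> n%:~R * x != m%:~R) ->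
  exists m n : int, `|n%:~R * x - m%:~R - y| < e.
Proof.
move=> e0 irr; have [m [n /andP[]]] := small_combination e0 irr.
set d := _ - _; rewrite normr_gt0 => d0 de.
pose k := Num.floor (y / d).
exists (k * m), (k * n); apply: le_lt_trans de.
have -> : (k * n)%:~R * x - (k * m)%:~R - y = - (y / d - k%:~R) * d.
  by rewrite !rmorphM /= /d; field.
rewrite mulNr normrN normrM -[leRHS]mul1r ler_wpM2r //.
have /andP[] := floor_itv (y / d); rewrite -/k intrD => kl kr.
by rewrite ler_norml; apply/andP; split; lra.
Qed.

End Angles.

(** * Rotation maps as immersions *)

Section RotationMaps.
Context {R : realType}.

Definition lform (V : normedModType R) (f : V -> R) : Prop :=
  linear (f : V -> R^o) /\ continuous f.

Section Lform.
Variable V : normedModType R.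
Implicit Types f g : V -> R.

Lemma lformD f g : lform f -> lform g -> lform (fun x => f x + g x).
Proof.
move=> [lf cf] [lg cg]; split=> [a x y|x]; last by apply: cvgD; [exact: cf|exact: cg].
by rewrite lf lg scalerDr addrACA.
Qed.

Lemma lformZ (c : R) f : lform f -> lform (fun x => c * f x).
Proof.
move=> [lf cf]; split=> [a x y|x].
  by rewrite lf mulrDr; congr (_ + _); rewrite [LHS]mulrCA.
by apply: cvgM; [exact: cvg_cst|exact: cf].
Qed.

Lemma lformN f : lform f -> lform (fun x => - f x).
Proof.
by move=> /(lformZ (-1)); rewrite (_ : (fun x => _) = fun x => - f x) //;
  apply/funext => x; rewrite mulN1r.
Qed.

End Lform.

Lemma lform_coord n (i : 'I_n) : lform (fun x : 'rV[R]_n => x 0 i : R).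
Proof. by split=> [a x y|]; [rewrite !mxE|exact: coord_continuous]. Qed.

Lemma lform_id : lform (fun x : R^o => x : R).
Proof. by split=> // x; exact: cvg_id. Qed.

Definition planes_orthogonal n (A B : 'I_n -> 'rV[R]_7) : Prop :=
  [/\ forall j k, scalar_prod (A j) (B k) = 0,
      forall j k, j != k -> scalar_prod (A j) (A k) = 0,
      forall j k, j != k -> scalar_prod (B j) (B k) = 0
    & forall k, scalar_prod (B k) (B k) = scalar_prod (A k) (A k)].

Variables (n : nat) (q0 : 'rV[R]_7) (A B : 'I_n -> 'rV[R]_7).

Section Smoothness.
Variables (V : normedModType R) (ell : 'I_n -> V -> R).
Hypothesis ell_form : forall k, lform (ell k).

Lemma smooth_rotate : smooth (fun x => rotate q0 A B (ell^~ x)).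
Proof.
move=> r; apply: CkD; first exact: Ck_cst.
by apply: Ck_sum => k; have [l c] := ell_form k; exact: Ck_circular.
Qed.

Lemma differentiable_rotate x : differentiable (fun x => rotate q0 A B (ell^~ x)) x.
Proof.
apply: differentiableD; first exact: differentiable_cst.
by apply: differentiable_sum_seq => k; have [l c] := ell_form k;
  exact: differentiable_circular.
Qed.

Lemma is_derive_rotate_map x v :
  is_derive x v (fun x => rotate q0 A B (ell^~ x))
    (\sum_k ell k v *: (cos (ell k x) *: B k - sin (ell k x) *: A k)).
Proof.
have D0 : is_derive x v (fun=> q0) (0 : 'rV[R]_7) by exact: is_derive_cst.
rewrite -[X in is_derive _ _ _ X]add0r.
apply: (is_deriveD D0); apply: is_derive_finsum => k.
have [l c] := ell_form k.
apply: is_derive_eq (is_derive_circular l c (A k) (B k) x v) _.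
by rewrite /circular; apply/rowP => i; rewrite !mxE; ring.
Qed.

Hypothesis orth : planes_orthogonal A B.

(** The images of the planes stay mutually orthogonal, so that the velocity
    vanishes only if the angular velocity of each nondegenerate circle does. *)
Lemma rotate_immersion :
  (forall v, (forall k, A k != 0 -> ell k v = 0) -> v = 0) ->
  immersion (fun x => rotate q0 A B (ell^~ x)).
Proof.
move=> ell_inj; split=> [|x]; first exact: smooth_rotate.
case: orth => AB AA BB BA.
have dE v := is_derive_differentiable (differentiable_rotate x) (is_derive_rotate_map x v).
move=> v w E; apply/eqP; rewrite -subr_eq0; apply/eqP/ell_inj => k Ak.
pose T j := cos (ell j x) *: B j - sin (ell j x) *: A j.
have TT j : scalar_prod (T j) (T k) = (j == k)%:R * scalar_prod (A k) (A k).
  have BA0 i : scalar_prod (B i) (A k) = 0 by rewrite spC.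
  rewrite !(spBl, spBr, spZl, spZr) !BA0 !AB.
  have [->|jk] := eqVneq j k.
    rewrite BA /= -[in RHS](cos2Dsin2 (ell k x)); ring.
  by rewrite AA // BB // /=; ring.
have : scalar_prod ('d (fun x => rotate q0 A B (ell^~ x)) x (v - w)) (T k) = 0.
  by rewrite linearB [X in X - _]E subrr sp0l.
rewrite dE sp_suml (bigD1 k) //= big1 => [|j jk].
  rewrite addr0 spZl TT eqxx mul1r => /eqP.
  by rewrite mulf_eq0 orbC gt_eqF ?sp_gt0 // => /eqP.
by rewrite spZl TT (negbTE jk) mul0r mulr0.
Qed.

End Smoothness.

Hypothesis orth : planes_orthogonal A B.

Lemma rotate_eq (th th' : 'I_n -> R) :
  rotate q0 A B th = rotate q0 A B th' <->
  forall k, A k != 0 -> exists z : int, th k = th' k + turn * z%:~R.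
Proof.
case: orth => AB AA BB BA.
have B0 k : A k = 0 -> B k = 0 by move=> Ak; apply: sp_eq0; rewrite BA Ak sp0l.
split=> [/addrI E k Ak|H].
  have r0 : scalar_prod (A k) (A k) != 0 by rewrite gt_eqF ?sp_gt0.
  apply: same_angle.
    have := congr1 (fun u => scalar_prod u (A k)) E; rewrite !sp_suml.
    rewrite (bigD1 k) //= big1 => [|j jk]; last first.
      by rewrite spDl !spZl AA // (spC (B j)) AB !mulr0 addr0.
    rewrite [RHS](bigD1 k) //= [X in _ = _ + X]big1 => [|j jk]; last first.
      by rewrite spDl !spZl AA // (spC (B j)) AB !mulr0 addr0.
    rewrite !addr0 !spDl !spZl (spC (B k)) AB !mulr0 !addr0.
    exact: mulIf.
  have := congr1 (fun u => scalar_prod u (B k)) E; rewrite !sp_suml.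
  rewrite (bigD1 k) //= big1 => [|j jk]; last first.
    by rewrite spDl !spZl BB // AB !mulr0 addr0.
  rewrite [RHS](bigD1 k) //= [X in _ = _ + X]big1 => [|j jk]; last first.
    by rewrite spDl !spZl BB // AB !mulr0 addr0.
  rewrite !addr0 !spDl !spZl BA AB !mulr0 !add0r.
  exact: mulIf.
congr (_ + _); apply: eq_bigr => k _; have [Ak|/H[z ->]] := eqVneq (A k) 0.
  by rewrite Ak B0 // !scaler0.
by have [-> ->] := cos_sin_turn (th' k) z.
Qed.

End RotationMaps.

(** * Orbits of two commuting rotations *)

Section Orbits.
Context {R : realType}.

(** The angles of an element of the maximal torus of [G2]: the third is determined
    by the first two, because the three have sum zero. *)
Definition balanced (x y : R) (k : 'I_3) : R := nth 0 [:: x; y; - (x + y)] k.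

Lemma lform_balanced (V : normedModType R) (f g : V -> R) k :
  lform f -> lform g -> lform (fun x => balanced (f x) (g x) k).
Proof.
move=> Lf Lg; move: k; apply: ord3_ind => //.
exact: lformN (lformD Lf Lg).
Qed.

(** Any two of three numbers with sum zero generate the same group as all three. *)
Lemma balanced_pair (P : R -> Prop) x y j k : j != k ->
  (forall a b, P a -> P b -> P (a + b)) -> (forall a, P a -> P (- a)) ->
  P (balanced x y j) -> P (balanced x y k) -> P x /\ P y.
Proof.
move=> jk PD PN.
have PB a b : P (- (a + b)) -> P a -> P b.
  move=> Pab Pa; rewrite -[b]opprK; apply: PN.
  by have := PD _ _ Pab Pa; rewrite opprD addrC addrA addrN add0r.
have PB' a b : P (- (a + b)) -> P b -> P a by rewrite addrC; exact: PB.
move: j k jk; apply: ord3_ind; apply: ord3_ind => //= _ Pj Pk; split=> //.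
- exact: PB Pk Pj.
- exact: PB' Pk Pj.
- exact: PB Pj Pk.
- exact: PB' Pj Pk.
Qed.

Lemma immersed_point (p : 'rV[R]_7) : immersed_torus 0 [set p].
Proof.
have E (x y : 'rV[R]_0) : x = y by apply/rowP => [[]].
exists (fun=> p); split.
- by split=> [k|x v w _]; [exact: Ck_cst|exact: E].
- by apply/seteqP; split=> [q [x _ <-]|q ->] //; exists 0.
- by move=> x y; split=> // _; exists 0; exact: E.
Qed.

Variables (q0 : 'rV[R]_7) (A B : 'I_3 -> 'rV[R]_7).
Hypothesis orth : planes_orthogonal A B.

Lemma circle_orbit (k0 : 'I_3) : (forall k, k != k0 -> A k = 0) -> A k0 != 0 ->
  immersed_torus 1 [set rotate q0 A B (fun=> s) | s in [set: R]].
Proof.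
move=> Ak Ak0; have Lf (k : 'I_3) : lform (fun x : 'rV[R]_1 => turn * x 0 0).
  exact: lformZ (lform_coord _).
exists (fun x => rotate q0 A B (fun=> turn * x 0 0)); split.
- have I := @rotate_immersion R 3 q0 A B 'rV[R]_1 (fun _ x => turn * x 0 0) Lf orth.
  apply: I => v /(_ _ Ak0)/eqP.
  rewrite mulf_eq0 (negbTE turn_neq0) /= => /eqP v0.
  by apply/rowP => i; rewrite ord1 v0 mxE.
- apply/seteqP; split=> [_ [x _ <-]|_ [s _ <-]]; first by exists (turn * x 0 0).
  exists (const_mx (turn^-1 * s)) => //; rewrite mxE mulVKf ?turn_neq0 //.
- move=> x y; rewrite rotate_eq //; split=> [/(_ _ Ak0)[z E]|[z ->] k _].
    exists (const_mx (- z)); apply/rowP => i; rewrite !mxE ord1.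
    apply: (mulfI turn_neq0); rewrite mulrDr E rmorphN mulrN /=; ring.
  exists (- z 0 0); rewrite !mxE rmorphN /=; ring.
Qed.

Section TwoPlanes.
Variables j k : 'I_3.
Hypotheses (jk : j != k) (Aj : A j != 0) (Ak : A k != 0).

Let G x y := rotate q0 A B (balanced x y).

Lemma balanced_eq x y x' y' : G x y = G x' y' <->
  exists z w : int, x = x' + turn * z%:~R /\ y = y' + turn * w%:~R.
Proof.
rewrite /G rotate_eq //; split=> [H|[z [w [-> ->]]] i _]; last first.
  move: i; apply: ord3_ind => /=; [by exists z|by exists w|].
  by exists (- (z + w)); rewrite /balanced /= rmorphN rmorphD /=; ring.
pose P (a : R) := exists z : int, a = turn * z%:~R.
have PD a b : P a -> P b -> P (a + b).
  by move=> [z ->] [w ->]; exists (z + w); rewrite rmorphD mulrDr.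
have PN a : P a -> P (- a) by move=> [z ->]; exists (- z); rewrite rmorphN mulrN.
have Pi i : A i != 0 -> P (balanced (x - x') (y - y') i).
  move=> /H[z E]; exists z; rewrite -[RHS](addKr (balanced x' y' i)) -E.
  by move: i {E}; apply: ord3_ind; rewrite /balanced /=; ring.
have [[z Ez] [w Ew]] := balanced_pair jk PD PN (Pi _ Aj) (Pi _ Ak).
by exists z, w; rewrite -Ez -Ew; split; ring.
Qed.

Lemma balanced_immersion (V : normedModType R) (f g : V -> R) :
  lform f -> lform g -> (forall v, f v = 0 -> g v = 0 -> v = 0) ->
  immersion (fun x => G (f x) (g x)).
Proof.
move=> Lf Lg fg0.
apply: (@rotate_immersion R 3 q0 A B V (fun k x => balanced (f x) (g x) k)) => //.
  by move=> i; exact: lform_balanced.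
move=> v H; have PD (a b : R) : a = 0 -> b = 0 -> a + b = 0 by move=> -> ->; rewrite addr0.
have PN (a : R) : a = 0 -> - a = 0 by move=> ->; rewrite oppr0.
by have [] := balanced_pair jk PD PN (H _ Aj) (H _ Ak); exact: fg0.
Qed.

Let Gt (x : 'rV[R]_2) := G (turn * x 0 0) (turn * x 0 1).

Let range_Gt : range Gt = [set G u.1 u.2 | u in [set: R * R]].
Proof.
apply/seteqP; split=> [_ [x _ <-]|_ [u _ <-]].
  by exists (turn * x 0 0, turn * x 0 1).
exists (\row_i (turn^-1 * nth 0 [:: u.1; u.2] i)) => //.
by rewrite /Gt !mxE /= !mulVKf ?turn_neq0.
Qed.

Lemma torus_orbit : immersed_torus 2 [set G u.1 u.2 | u in [set: R * R]].
Proof.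
exists Gt; split; last 2 first.
- exact: range_Gt.
- move=> x y; rewrite balanced_eq; split.
    move=> [z [w [Ez Ew]]]; exists (\row_i nth 0 [:: - z; - w] i).
    apply/rowP; apply: ord2_ind; rewrite !mxE /= rmorphN /=;
      apply: (mulfI turn_neq0); rewrite mulrDr ?Ez ?Ew; ring.
  move=> [z ->]; exists (- z 0 0), (- z 0 1); rewrite !mxE !rmorphN /=.
  by split; ring.
apply: balanced_immersion; try exact: lformZ (lform_coord _).
move=> v /eqP; rewrite mulf_eq0 (negbTE turn_neq0) /= => /eqP v0 /eqP.
rewrite mulf_eq0 (negbTE turn_neq0) /= => /eqP v1.
by apply/rowP; apply: ord2_ind; rewrite mxE.
Qed.

(** Along a rational direction the least period is reached at the primitive
    integer vector of that direction. *)
Lemma periodic_orbit (lam : R) (z0 z1 : int) : lam != 0 -> (z0 != 0) || (z1 != 0) ->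
  immersed_torus 1 [set G (s * (lam * z0%:~R)) (s * (lam * z1%:~R)) | s in [set: R]].
Proof.
move=> lam0 z01; pose g := gcdz z0 z1.
have g0 : g != 0 by rewrite /g gcdz_eq0 negb_and.
have [u [v uv]] := Bezoutz z0 z1; pose n0 := (z0 %/ g)%Z; pose n1 := (z1 %/ g)%Z.
have z0E : z0 = n0 * g by rewrite divzK // dvdz_gcdl.
have z1E : z1 = n1 * g by rewrite divzK // dvdz_gcdr.
have uvn : (u%:~R * n0%:~R + v%:~R * n1%:~R : R) = 1.
  rewrite -!intrM -intrD; suff -> : u * n0 + v * n1 = 1 by [].
  by apply: (mulIf g0); rewrite mulrDl -!mulrA -z0E -z1E uv mul1r.
have gR : g%:~R != 0 :> R by rewrite intr_eq0.
exists (fun x => G (turn * n0%:~R * x 0 0) (turn * n1%:~R * x 0 0)); split.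
- apply: balanced_immersion; try exact: lformZ (lform_coord _).
  move=> x e0 e1; apply/rowP => i; rewrite ord1 mxE; apply: (mulfI turn_neq0).
  rewrite mulr0 -[x 0 0]mul1r -uvn.
  have -> : turn * ((u%:~R * n0%:~R + v%:~R * n1%:~R) * x 0 0)
    = u%:~R * (turn * n0%:~R * x 0 0) + v%:~R * (turn * n1%:~R * x 0 0) by ring.
  by rewrite e0 e1 !mulr0 addr0.
- apply/seteqP; split=> [_ [x _ <-]|_ [s _ <-]].
    exists (turn * x 0 0 / (lam * g%:~R)) => //.
    by rewrite z0E z1E !intrM; congr G; field; rewrite ?gR ?lam0 //.
  exists (const_mx (s * lam * g%:~R / turn)) => //.
  rewrite z0E z1E !intrM !mxE; congr G; field; exact: turn_neq0.
- move=> x y; rewrite balanced_eq; split.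
    move=> [a [b [Ea Eb]]]; exists (const_mx (- (u * a + v * b))).
    apply/rowP => i; rewrite !mxE ord1 rmorphN rmorphD !rmorphM /=.
    apply: (mulfI turn_neq0).
    have -> : turn * (x 0 0 - (u%:~R * a%:~R + v%:~R * b%:~R))
      = turn * x 0 0 - (u%:~R * (turn * a%:~R) + v%:~R * (turn * b%:~R)) by ring.
    have -> : turn * a%:~R = turn * n0%:~R * (x 0 0 - y 0 0) by rewrite mulrBr Ea; ring.
    have -> : turn * b%:~R = turn * n1%:~R * (x 0 0 - y 0 0) by rewrite mulrBr Eb; ring.
    have -> : u%:~R * (turn * n0%:~R * (x 0 0 - y 0 0)) + v%:~R * (turn * n1%:~R * (x 0 0 - y 0 0))
      = (u%:~R * n0%:~R + v%:~R * n1%:~R) * turn * (x 0 0 - y 0 0) by ring.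
    rewrite uvn; ring.
  move=> [z ->]; exists (- (n0 * z 0 0)), (- (n1 * z 0 0)).
  by rewrite !mxE !rmorphN !rmorphM /=; split; ring.
Qed.

Definition commensurable (w0 w1 : R) : Prop :=
  exists (lam : R) (z0 z1 : int), w0 = lam * z0%:~R /\ w1 = lam * z1%:~R.

(** A line that met a point twice would be periodic, which makes its direction
    rational. *)
Lemma line_orbit (w0 w1 : R) : ~ commensurable w0 w1 ->
  injectively_immersed_line [set G (s * w0) (s * w1) | s in [set: R]].
Proof.
move=> irr; exists (fun s : R^o => G (w0 * s) (w1 * s)); split.
- apply: balanced_immersion; try exact: lformZ lform_id.
  move=> v /eqP + /eqP; rewrite !mulf_eq0; have [//|_] := eqVneq (v : R) 0.
  rewrite !orbF => /eqP w00 /eqP w10; case: irr.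
  by exists 0, 0, 0; rewrite w00 w10 !mul0r.
- move=> s s' /balanced_eq[a [b [Ea Eb]]]; apply/eqP/negPn/negP => ss.
  have ds : s - s' != 0 by rewrite subr_eq0.
  case: irr; exists (turn / (s - s')), a, b.
  have Fa : w0 * (s - s') = turn * a%:~R by rewrite mulrBr Ea; ring.
  have Fb : w1 * (s - s') = turn * b%:~R by rewrite mulrBr Eb; ring.
  by split; apply: (mulIf ds); rewrite ?Fa ?Fb; field.
- by apply/seteqP; split=> [_ [s _ <-]|_ [s _ <-]]; exists s => //; rewrite 2![_ * s]mulrC.
Qed.

Let Gt_continuous : continuous Gt.
Proof.
move=> x; apply: differentiable_continuous.
have Lf (i : 'I_3) : lform (fun x : 'rV[R]_2 => balanced (turn * x 0 0) (turn * x 0 1) i).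
  by apply: lform_balanced; exact: lformZ (lform_coord _).
exact: (@differentiable_rotate R 3 q0 A B 'rV[R]_2 _ Lf x).
Qed.

Let closed_Gt : closed (range Gt).
Proof.
pose K : set 'rV[R]_2 := [set v | forall i, `[0, 1]%classic (v ord0 i)].
have -> : range Gt = Gt @` K.
  apply/seteqP; split=> [_ [x _ <-]|_ [x _ <-]]; last by exists x.
  exists (\row_i (x 0 i - (Num.floor (x 0 i))%:~R)).
    move=> i /=; rewrite mxE in_itv /=; have /andP[] := floor_itv (x 0 i).
    by rewrite intrD => *; apply/andP; split; lra.
  apply/balanced_eq; exists (- Num.floor (x 0 0)), (- Num.floor (x 0 1)).
  by rewrite !mxE !rmorphN /=; split; ring.
apply: compact_closed; first exact: norm_hausdorff.
apply: continuous_compact; first exact: continuous_subspaceT.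
exact: (@rV_compact R 2 (fun=> `[0, 1]%classic) (fun=> @segment_compact R 0 1)).
Qed.

(** The torus is compact, hence closed. Conversely the line meets each circle of
    constant first angle in the translates, modulo a turn, of one point by the
    multiples of [w1 / w0], so that Kronecker's theorem gives density. *)
Lemma line_orbit_closure (w0 w1 : R) : ~ commensurable w0 w1 ->
  closure [set G (s * w0) (s * w1) | s in [set: R]]
  = [set G u.1 u.2 | u in [set: R * R]].
Proof.
move=> irr; rewrite -range_Gt; apply/seteqP; split.
  apply: subset_trans closed_Gt; apply: closureS.
  by rewrite range_Gt => _ [s _ <-]; exists (s * w0, s * w1).
have w00 : w0 != 0.
  by apply/eqP => w00; case: irr; exists w1, 0, 1; rewrite w00 mulr0 mulr1.
have al_irr (m n : int) : n != 0 -> n%:~R * (w1 / w0) != m%:~R.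
  move=> n0; apply/eqP => E; case: irr; exists (w0 / n%:~R), n, m.
  have nR : n%:~R != 0 :> R by rewrite intr_eq0.
  by rewrite -E; split; field; rewrite ?w00 ?nR.
move=> _ [x _ <-] U /Gt_continuous; rewrite nbhs_simpl => /nbhs_ballP[e /= e0 eB].
have [m [n mn]] := irrational_dense (x 0 1 - x 0 0 * (w1 / w0)) e0 al_irr.
pose y : 'rV[R]_2 := \row_i nth 0 [:: x 0 0; (x 0 0 + n%:~R) * (w1 / w0) - m%:~R] i.
exists (Gt y); split; last first.
  apply: eB; split=> // i; apply: ord2_ind; rewrite ord1 /ball /= !mxE /= ?subrr ?normr0 // distrC.
  by congr (`|_| < _): mn; ring.
(* The time at which the first angle has made n turns more than x 0 0. *)
exists (turn * (x 0 0 + n%:~R) / w0) => //.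
apply/balanced_eq; exists n, m; rewrite !mxE /=; split; field; exact: w00.
Qed.

Lemma rank_one_orbit (w0 w1 : R) :
  let O := [set G (s * w0) (s * w1) | s in [set: R]] in
  (exists d : nat, (d <= 2)%N /\ immersed_torus d O) \/
  (injectively_immersed_line O /\ immersed_torus 2 (closure O)).
Proof.
move=> O; have [[lam [z0 [z1 [w0E w1E]]]]|irr] := pselect (commensurable w0 w1); last first.
  right; split; first exact: line_orbit.
  by rewrite /O line_orbit_closure //; exact: torus_orbit.
left; have [/andP[lam0 z01]|] := boolP ((lam != 0) && ((z0 != 0) || (z1 != 0))).
  by exists 1; split=> //; rewrite /O w0E w1E; exact: periodic_orbit.
move=> deg; exists 0; split=> //; have -> : O = [set G 0 0].
  have w00 : w0 = 0 /\ w1 = 0.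
    move: deg; rewrite negb_and negb_or !negbK w0E w1E.
    move=> /orP[/eqP ->|/andP[/eqP -> /eqP ->]]; by rewrite ?mul0r ?mulr0.
  rewrite /O; have [-> ->] := w00; apply/seteqP; split=> [_ [s _ <-]|_ ->].
    by rewrite /= !mulr0.
  by exists 0 => //; rewrite mulr0.
exact: immersed_point.
Qed.

End TwoPlanes.

(** The orbit of two commuting one-parameter groups of rotations: the subgroup of
    the torus swept out by two vectors of angular velocities has dimension at most
    two, and is either closed or a dense line in the whole torus. *)
Lemma orbit_trichotomy (l m : 'I_3 -> R) :
  l ord_max = - (l 0 + l 1) -> m ord_max = - (m 0 + m 1) ->
  let O := range (fun t : 'rV[R]_2 => rotate q0 A B (fun k => t 0 0 * l k + t 0 1 * m k)) in
  (exists d : nat, (d <= 2)%N /\ immersed_torus d O) \/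
  (injectively_immersed_line O /\ immersed_torus 2 (closure O)).
Proof.
move=> l2 m2 O.
pose pair (a b : R) : 'rV[R]_2 := \row_i nth 0 [:: a; b] i.
have pair0 a b : pair a b 0 0 = a by rewrite mxE.
have pair1 a b : pair a b 0 1 = b by rewrite mxE.
have bal (t : 'rV[R]_2) :
    (fun k => t 0 0 * l k + t 0 1 * m k)
    = balanced (t 0 0 * l 0 + t 0 1 * m 0) (t 0 0 * l 1 + t 0 1 * m 1).
  apply/funext; apply: ord3_ind; rewrite /balanced //=.
  by rewrite l2 m2; ring.
have [[j [k [jk [Aj Ak]]]]|few] := pselect (exists j k, j != k /\ A j != 0 /\ A k != 0).
  have [det0|det] := eqVneq (l 0 * m 1 - l 1 * m 0) 0; last first.
    left; exists 2; split=> //.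
    suff -> : O = [set rotate q0 A B (balanced u.1 u.2) | u in [set: R * R]].
      exact: torus_orbit jk Aj Ak.
    apply/seteqP; split=> [_ [t _ <-]|_ [[u v] _ <-]] /=; rewrite ?bal.
      by exists (t 0 0 * l 0 + t 0 1 * m 0, t 0 0 * l 1 + t 0 1 * m 1).
    exists (pair ((u * m 1 - v * m 0) / (l 0 * m 1 - l 1 * m 0))
                 ((v * l 0 - u * l 1) / (l 0 * m 1 - l 1 * m 0))) => //.
    rewrite bal pair0 pair1; congr (rotate _ _ _ (balanced _ _)); field; exact: det.
  suff [w0 [w1 ->]] : exists w0 w1, O =
      [set rotate q0 A B (balanced (s * w0) (s * w1)) | s in [set: R]].
    exact: rank_one_orbit jk Aj Ak w0 w1.
  (* Both vectors of velocities are multiples, not both zero, of (w0, w1). *)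
  have rank1 w0 w1 c d : l 0 = c * w0 -> l 1 = c * w1 -> m 0 = d * w0 -> m 1 = d * w1 ->
      (exists a b, a * c + b * d = 1) ->
      O = [set rotate q0 A B (balanced (s * w0) (s * w1)) | s in [set: R]].
    move=> l0 l1 m0 m1 [a [b ab]]; apply/seteqP; split=> [_ [t _ <-]|_ [s _ <-]].
      exists (t 0 0 * c + t 0 1 * d) => //; rewrite bal l0 l1 m0 m1.
      by congr (rotate _ _ _ (balanced _ _)); ring.
    exists (pair (s * a) (s * b)) => //; rewrite bal pair0 pair1 l0 l1 m0 m1.
    have E w : s * a * (c * w) + s * b * (d * w) = s * w.
      by rewrite -[in RHS](mul1r w) -ab; ring.
    by rewrite !E.
  have [l0|l0] := eqVneq (l 0) 0; last first.
    exists (l 0), (l 1); apply: (rank1 _ _ 1 (m 0 / l 0)).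
    - by rewrite mul1r.
    - by rewrite mul1r.
    - by field.
    - apply: (mulfI l0); apply/eqP; rewrite -subr_eq0 -det0; apply/eqP; by field.
    - by exists 1, 0; rewrite mul1r mul0r addr0.
  have [l1|l1] := eqVneq (l 1) 0; last first.
    exists (l 0), (l 1); apply: (rank1 _ _ 1 (m 1 / l 1)).
    - by rewrite mul1r.
    - by rewrite mul1r.
    - apply/eqP; move: det0 => /eqP; rewrite l0 mul0r sub0r oppr_eq0 mulf_eq0.
      by rewrite (negbTE l1) mulr0.
    - by field.
    - by exists 1, 0; rewrite mul1r mul0r addr0.
  exists (m 0), (m 1); apply: (rank1 _ _ 0 1); rewrite ?mul0r ?mul1r //.
  by exists 0, 1; rewrite mul1r mul0r add0r.
left.
(* At most one circle is nondegenerate, and only its angle matters. *)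
have [k0 Hk0] : exists k0, forall k, k != k0 -> A k = 0.
  have [[k0 Ak0]|none] := pselect (exists k0, A k0 != 0).
    exists k0 => k kk0; apply/eqP/negPn/negP => Ak; apply: few.
    by exists k, k0.
  by exists 0 => k _; apply/eqP/negPn/negP => Ak; apply: none; exists k.
have only th th' : (A k0 != 0 -> th k0 = th' k0) -> rotate q0 A B th = rotate q0 A B th'.
  move=> E; apply/rotate_eq => // k Ak; exists 0; rewrite mulr0 addr0.
  have [kk0|/Hk0 Ak0] := eqVneq k k0; last by rewrite Ak0 eqxx in Ak.
  by move: Ak; rewrite kk0.
have [/andP[Ak0 lm]|deg] := boolP ((A k0 != 0) && ((l k0 != 0) || (m k0 != 0))).
  exists 1; split=> //.
  suff -> : O = [set rotate q0 A B (fun=> s) | s in [set: R]] by exact: circle_orbit Ak0.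
  apply/seteqP; split=> [_ [t _ <-]|_ [s _ <-]].
    by exists (t 0 0 * l k0 + t 0 1 * m k0) => //; exact: only.
  have [l0|l0] := eqVneq (l k0) 0; last first.
    by exists (pair (s / l k0) 0) => //; apply: only => _; rewrite pair0 pair1; field.
  move: lm; rewrite l0 eqxx /= => m0.
  by exists (pair 0 (s / m k0)) => //; apply: only => _; rewrite pair0 pair1; field.
exists 0; split=> //.
suff -> : O = [set rotate q0 A B (fun=> 0)] by exact: immersed_point.
have E (t : 'rV[R]_2) :
    rotate q0 A B (fun k => t 0 0 * l k + t 0 1 * m k) = rotate q0 A B (fun=> 0).
  apply: only => Ak0; move: deg; rewrite Ak0 /= negb_or !negbK => /andP[/eqP -> /eqP ->].
  by rewrite !mulr0 addr0.
by apply/seteqP; split=> [_ [t _ <-]|_ ->] /=; [exact: E|exists 0].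
Qed.

End Orbits.

(** * The composed flows *)

Section ComposedFlows.
Context {R : realType}.
Variables xi eta : 'M[R]_7.
Hypotheses (der1 : derivation xi^T) (der2 : derivation eta^T).
Variables (p q0 : 'rV[R]_7) (A B : 'I_3 -> 'rV[R]_7) (l m : 'I_3 -> R).
Hypotheses (pp : sphere R p)
  (dec : rotation_decomposition xi^T eta^T p q0 A B l m).

Let psi (t : 'rV[R]_2) :=
  flow (fundamental eta) (t 0 1) (flow (fundamental xi) (t 0 0) p).
Let angle k (t : 'rV[R]_2) : R := t 0 0 * l k + t 0 1 * m k.

Lemma rotate0 : rotate q0 A B (fun=> 0) = p.
Proof.
case: dec => -> _ _ _ _; congr (_ + _); apply: eq_bigr => k _.
by rewrite cos0 sin0 scale1r scale0r addr0.
Qed.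

Let rotate_xi k : A k *m xi^T = l k *: B k /\ B k *m xi^T = - (l k *: A k).
Proof. by case: dec => _ _ /(_ k)[]. Qed.

Let rotate_eta k : A k *m eta^T = m k *: B k /\ B k *m eta^T = - (m k *: A k).
Proof. by case: dec => _ _ /(_ k)[]. Qed.

Let axis_xi : q0 *m xi^T = 0. Proof. by case: dec => _ []. Qed.
Let axis_eta : q0 *m eta^T = 0. Proof. by case: dec => _ []. Qed.

Let start : sphere R (rotate q0 A B (fun=> 0)).
Proof. by rewrite rotate0. Qed.

Let first_flow (s : R) : flow (fundamental xi) s p = rotate q0 A B (fun k => 0 + s * l k).
Proof. by rewrite -[in LHS]rotate0; exact: (flow_rotate der1 axis_xi rotate_xi start s). Qed.

Let middle (s : R) : sphere R (rotate q0 A B (fun k => 0 + s * l k)).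
Proof. exact: (rotate_sphere der1 axis_xi rotate_xi start s). Qed.

Let second_flow t : psi t = rotate q0 A B (fun k => 0 + t 0 0 * l k + t 0 1 * m k).
Proof.
apply: etrans (congr1 (flow (fundamental eta) (t 0 1)) (first_flow (t 0 0))) _.
exact: (flow_rotate der2 axis_eta rotate_eta (middle _)).
Qed.

Lemma composed_flows_rotate : psi = fun t => rotate q0 A B (angle^~ t).
Proof.
apply/funext => t; rewrite second_flow.
by congr rotate; apply/funext => k; rewrite add0r.
Qed.

Lemma composed_flows_sphere t : sphere R (psi t).
Proof.
rewrite second_flow; exact: (rotate_sphere der2 axis_eta rotate_eta (middle _) _).
Qed.

Lemma angle_lform k : lform (angle k).
Proof.
apply: lformD; under eq_fun do rewrite mulrC; exact: lformZ (lform_coord _).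
Qed.

Lemma composed_flows_smooth : smooth psi.
Proof. rewrite composed_flows_rotate; exact: smooth_rotate angle_lform. Qed.

(** As the composed flows rotate every plane by a sum of two angles, the partial
    derivatives at each time are the values of the two fundamental fields. *)
Lemma composed_flows_jacobian t :
  delta_mx 0 0 *m 'J psi t = psi t *m xi^T /\ delta_mx 0 1 *m 'J psi t = psi t *m eta^T.
Proof.
rewrite composed_flows_rotate.
have D v := mul_jacobian (differentiable_rotate q0 A B angle_lform t)
  (is_derive_rotate_map q0 A B angle_lform t v).
rewrite !D (rotation_field _ axis_xi rotate_xi) (rotation_field _ axis_eta rotate_eta).
by split; apply: eq_bigr => k _; congr (_ *: _); rewrite /angle !mxE /=; ring.
Qed.

End ComposedFlows.


Theorem proposition4p7 (R : realType) (theta : dform R 2 7)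
    (theta_form : sphere_form theta)
    (theta_potential : sphere_form_eq (sphere_d theta) octonion_form)
    (theta_invariant : G2_invariant theta)
    (xi eta : 'M[R]_7) (xi_g2 : g2 R xi) (eta_g2 : g2 R eta)
    (xi_eta : lie_bracket xi eta = 0) :
  let X := fundamental xi in
  let Y := fundamental eta in
  let Z : 'rV[R]_7 -> bivector R 7 := fun p => wedge_vectors (X p) (Y p) in
  let H : 'rV[R]_7 -> R := fun p => - iota_bivector (k := 0) (Z p) (theta p) 0 in
  hdw_solution octonion_form H Z /\
  forall p : 'rV[R]_7, sphere R p ->
    let psi : 'rV[R]_2 -> 'rV[R]_7 :=
      fun t => flow Y (t 0 1) (flow X (t 0 0) p) in
    dynamical_hdw_solution octonion_form H coordinate_covolume psi /\
    ((exists k : nat, (k <= 2)%N /\ immersed_torus k (range psi)) \/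
     (injectively_immersed_line (range psi) /\
      immersed_torus 2 (closure (range psi)))).
Proof.
move=> X Y Z H.
have der1 := g2_derivation xi_g2; have der2 := g2_derivation eta_g2.
have comm : xi^T *m eta^T = eta^T *m xi^T.
  move: xi_eta => /eqP; rewrite subr_eq0 => /eqP E.
  by rewrite -!trmx_mul; congr (_^T).
have ZE : Z = fun p => wedge_vectors (p *m xi^T) (p *m eta^T).
  by apply/funext => p; rewrite /Z /X /Y !fundamentalE.
have HE : H = fun p => - theta p (col_mx (p *m xi^T) (p *m eta^T)).
  by apply/funext => p; rewrite /H ZE /iota_bivector /wedge_vectors col_mx_empty.
have Hd p (v : 'M[R]_(1, 7)) : sphere R p -> tangent p v ->
    octonion_form p (col_mx (col_mx (p *m xi^T) (p *m eta^T)) v)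
    = - sphere_d (form_of_fun H) p v.
  by rewrite HE; exact: hamiltonian_d.
split.
  split=> [||p pp v vp].
  - by rewrite HE; exact: hamiltonian_form.
  - by rewrite ZE; exact: bivector_field.
  - by rewrite ZE; exact: Hd.
move=> p pp psi.
have [q0 [A [B [l [m dec]]]]] := rotation_decomposition_exists der1 der2 comm p.
split.
  split=> [|t|t v tv].
  - exact: (composed_flows_smooth der1 der2 pp dec).
  - exact: (composed_flows_sphere der1 der2 pp dec).
  have [J0 J1] := composed_flows_jacobian der1 der2 pp dec t.
  rewrite -Hd //; last exact: (composed_flows_sphere der1 der2 pp dec).
  by rewrite -J0 -J1 -mul_pair.
have -> : psi = fun t => rotate q0 A B (fun k => t 0 0 * l k + t 0 1 * m k).
  exact: (composed_flows_rotate der1 der2 pp dec).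
by case: dec => _ _ _ [l2 m2] orth; exact: orbit_trichotomy.
Qed.
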